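(* Let $a\in\mathbf R$. Let $B_2\subset B_1\subset B$ and $B_{2b}\subset B_{1b}\subset B_b$ be two Banach triples with norms $\|\cdot\|_2,\|\cdot\|_1,\|\cdot\|$ and $\|\cdot\|_{2b},\|\cdot\|_{1b},\|\cdot\|_b$, and let $B^{con}$ be another Banach space with norm $\|\cdot\|_{con}$. Assume: (i) $D=(D_1,\dots,D_n)$ and $D^b=(D_{1b},\dots,D_{nb})$, where $D_i\in\mathcal L(B_1,B)\cap\mathcal L(B_2,B_1)$ and $D_{ib}\in\mathcal L(B_{1b},B_b)\cap\mathcal L(B_{2b},B_{1b})$, all these operators having norms bounded by $1$ in the respective spaces. (ii) $A\in\mathcal L(B_2,B)$ generates a strongly continuous semigroup $e^{At}$ in both $B$ and $B_1$, with $\|e^{At}\|_{B\to B}\le Me^{mt}$, $\|e^{At}\|_{B_1\to B_1}\le M_1e^{m_1t}$ for nonnegative constants $M,m,M_1,m_1$, and $B_2$ is an invariant core for this semigroup in $B$. Likewise $A^b\in\mathcal L(B_{2b},B_b)$ generates a strongly continuous semigroup $e^{A^bt}$ in both $B_b$ and $B_{1b}$, with $\|e^{A^bt}\|_{B_b\to B_b}\le M_be^{m_bt}$, $\|e^{A^bt}\|_{B_{1b}\to B_{1b}}\le M_{1b}e^{m_{1b}t}$ for nonnegative constants $M_b,m_b,M_{1b},m_{1b}$, and $B_{2b}$ is an invariant core for this semigroup in $B_b$. (iii) $H:\mathbf R\times B\times B^n\times B^{con}\to B$ is continuous and, for some constants $L_H,L_H',L_H^{par}$ and all arguments, $$\|H(t,b_0,\dots,b_n,u)-H(t,\tilde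 b_0,\dots,\tilde b_n,u)\|\le L_H\sum_{j=0}^n\|b_j-\tilde b_j\|\Big(1+L_H'\sum_{j=1}^n\|b_j\|\Big),$$ $$\|H(t,b_0,\dots,b_n,u)-H(t,b_0,\dots,b_n,\tilde u)\|\le L_H^{par}\|u-\tilde u\|_{con}\Big(1+\sum_{j=1}^n\|b_j\|\Big),$$ $$\|H(t,b_0,\dots,b_n,u)\|\le L_H\sum_{j=1}^n\|b_j\|.$$ For $T>a$, $H^b:\mathbf R\times B_b\times(B_b)^n\times C([a,T],B)\to B_b$ is continuous, $H^b(t,f_0,\dots,f_n,b(\cdot))$ depends on the curve $b(\cdot)$ only through its future values $b_{\ge t}=\{b(s):s\in[t,T]\}$, and, for some constants $L_H^b,(L_H^b)'$ not depending on $T$ and all arguments, $$\|H^b(t,f_0,\dots,f_n,b(\cdot))-H^b(t,\tilde f_0,\dots,\tilde f_n,b(\cdot))\|_b\le L^b_H\sum_{j=0}^n\|f_j-\tilde f_j\|_b\Big(1+(L_H^b)'\sum_{j=1}^n\|f_j\|_b\Big),$$ $$\|H^b(t,f_0,\dots,f_n,b(\cdot))-H^b(t,f_0,\dots,f_n,\tilde b(\cdot))\|_b\le L^b_H\|b-\tilde b\|_{C([a,T],B)}\Big(1+\sum_{j=0}^n\|f_j\|_b\Big),$$ $$\|H^b(t,f_0,\dots,f_n,b(\cdot))\|_b\le L^b_H\sum_{j=1}^n\|f_j\|_b.$$ (iv) $u:\mathbf R\times B_b\times(B_b)^n\to B^{con}$ is continuous and, for some constant $L_u$, $$\|u(t,f_0,\dots,f_n)-u(t,\tilde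 f_0,\dots,\tilde f_n)\|_{con}\le L_u\sum_{j=0}^n\|f_j-\tilde f_j\|_b.$$ (v) For $t>0$, $e^{At}$ takes $B$ to $B_1$ and $e^{A^bt}$ takes $B_b$ to $B_{1b}$, and for $t\in(0,1]$ one has $\|e^{At}\|_{B\to B_1}\le\varkappa t^{-\omega}$ and $\|e^{A^bt}\|_{B_b\to B_{1b}}\le\varkappa t^{-\omega}$ with some constants $\varkappa>0$, $\omega\in(0,1)$. Then for any $Y\in B_1$, $Z\in B_{1b}$ there exists $T_0>a$ such that for all $T\in(a,T_0)$ the forward-backward system $$\begin{cases}\dot b(t)=Ab(t)+H(t,b(t),Db(t),u(t,f(t),D^bf(t))),& b(a)=Y,\\ \dot f(t)=-A^bf(t)+H^b(t,f(t),D^bf(t),b_{\ge t}),& f(T)=Z,\end{cases}\qquad t\in[a,T],$$ has a unique mild solution $(b(t),f(t))$, which depends locally Lipschitz on $Y,Z$, that is, Lipschitz continuously when $Y$ and $Z$ are taken from bounded sets.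
   Context: $\mathcal L(B,C)$ is the Banach space of bounded linear operators $B\to C$ with operator norm $\|\cdot\|_{B\to C}$. $C([a,T],B)$ is the Banach space of continuous functions $[a,T]\to B$ with the sup-norm. A Banach triple is a sequence of embedded Banach spaces $B_2\subset B_1\subset B$ with norms satisfying $\|\cdot\|_2\ge\|\cdot\|_1\ge\|\cdot\|$ (on the spaces where they are defined), such that $B_2$ is dense in $B_1$ in the topology of $B_1$ and $B_1$ is dense in $B$ in the topology of $B$. $Db=(D_1b,\dots,D_nb)$, $D^bf=(D_{1b}f,\dots,D_{nb}f)$. A mild solution of the system is a pair $(b,f)\in C([a,T],B_1)\times C([a,T],B_{1b})$ satisfying, for $t\in[a,T]$, $$b(t)=e^{A(t-a)}Y+\int_a^te^{A(t-s)}H(s,b(s),Db(s),u(s,f(s),D^bf(s)))\,ds,$$ $$f(t)=e^{A^b(T-t)}Z-\int_t^Te^{A^b(s-t)}H^b(s,f(s),D^bf(s),b_{\ge s})\,ds.$$ *)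

(* Defs.v *)
From Stdlib Require Import Reals.
From mathcomp Require Import ssreflect ssrfun ssrbool eqtype ssrnat seq fintype bigop.
From Coquelicot Require Import Coquelicot.

Set Implicit Arguments.
Unset Strict Implicit.
Unset Printing Implicit Defensive.

Local Open Scope R_scope.

Notation Banach := (CompleteNormedModule R_AbsRing).

(* Meaningful for [is_linear l] (which includes boundedness in Coquelicot):
   then the supremum is finite and [real] returns it. *)
Definition op_norm {V W : NormedModule R_AbsRing} (l : V -> W) : R :=
  real (Lub_Rbar (fun r => exists x : V, norm x <= 1 /\ r = norm (l x))).

Definition sum_norm {n : nat} {V : NormedModule R_AbsRing} (v : 'I_n -> V) : R :=
  \big[Rplus/0]_(j < n) norm (v j).

Definition diff {n : nat} {V : NormedModule R_AbsRing} (v w : 'I_n -> V) : 'I_n -> V :=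
  fun j => minus (v j) (w j).

(* Function types ['I_n -> V] carry Coquelicot's uniform structure
   [fct_UniformSpace], which for the finite index set 'I_n is the product
   structure of V^n. *)
Definition jointly_continuous3 {T1 T2 T3 U : UniformSpace}
    (F : T1 -> T2 -> T3 -> U) : Prop :=
  forall p : T1 * T2 * T3,
    continuous (fun q : T1 * T2 * T3 => F q.1.1 q.1.2 q.2) p.

Definition jointly_continuous4 {T1 T2 T3 T4 U : UniformSpace}
    (F : T1 -> T2 -> T3 -> T4 -> U) : Prop :=
  forall p : T1 * T2 * T3 * T4,
    continuous (fun q : T1 * T2 * T3 * T4 => F q.1.1.1 q.1.1.2 q.1.2 q.2) p.

(* The inclusion V ⊂ W of one Banach space as a dense subspace of another,
   with a norm dominating that of W. A Banach triple B2 ⊂ B1 ⊂ B is given by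
   [dense_inclusion B1 B] and [dense_inclusion B2 B1]. *)
Record dense_inclusion (V W : Banach) := DenseInclusion {
  incl :> V -> W;
  incl_linear : is_linear incl;
  incl_inj : forall x y, incl x = incl y -> x = y;
  incl_norm : forall x, norm (incl x) <= norm x;
  incl_dense : forall (y : W) (eps : R), 0 < eps ->
    exists x : V, norm (minus (incl x) y) < eps }.

(* [Contin a T V] is C([a,T], V). Its elements are represented by total
   functions whose restriction to [a,T] is continuous; values outside [a,T]
   are junk, ignored by the uniform structure and by [Cdist] below. *)
Record Contin (a T : R) (V : UniformSpace) := MkContin {
  cfun :> R -> V;
  cfun_cont : continuous_on (fun t => a <= t <= T) cfun }.

Lemma const_cont (a T : R) (V : UniformSpace) (x : V) :
  continuous_on (fun t : R => a <= t <= T) (fun _ => x).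
Proof. by move=> t _; apply: filterlim_const. Qed.

Section ContinUniform.
Variables (a T : R) (V : UniformSpace).

(* The topology of uniform convergence on [a,T], i.e. that of the sup-norm. *)
Definition Contin_ball (f : Contin a T V) (eps : R) (g : Contin a T V) : Prop :=
  forall t, a <= t <= T -> ball (f t) eps (g t).

Lemma Contin_ball_center (f : Contin a T V) (eps : posreal) : Contin_ball f eps f.
Proof. by move=> t _; apply: ball_center. Qed.

Lemma Contin_ball_sym (f g : Contin a T V) (eps : R) :
  Contin_ball f eps g -> Contin_ball g eps f.
Proof. by move=> fg t at_; apply: ball_sym; apply: fg. Qed.

Lemma Contin_ball_triangle (f g h : Contin a T V) (e1 e2 : R) :
  Contin_ball f e1 g -> Contin_ball g e2 h -> Contin_ball f (e1 + e2) h.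
Proof. by move=> fg gh t at_; apply: ball_triangle (fg t at_) (gh t at_). Qed.

Definition Contin_UniformSpace_mixin :=
  UniformSpace.Mixin (Contin a T V)
    (MkContin (@const_cont a T V (UniformSpace.point_of _ (UniformSpace.class V))))
    Contin_ball Contin_ball_center Contin_ball_sym Contin_ball_triangle.

Canonical Contin_UniformSpace :=
  UniformSpace.Pack (Contin a T V) Contin_UniformSpace_mixin (Contin a T V).

End ContinUniform.

(* The sup-norm distance ||f - g|| in C([a,T], V). *)
Definition Cdist {a T : R} {V : NormedModule R_AbsRing} (f g : Contin a T V) : R :=
  real (Lub_Rbar (fun r => exists t, a <= t <= T /\ r = norm (minus (f t) (g t)))).

Lemma incl_cont (V W : Banach) (j : dense_inclusion V W) (a T : R) (f : Contin a T V) :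
  continuous_on (fun t : R => a <= t <= T) (fun t => j (f t)).
Proof.
move=> t at_.
apply: (filterlim_comp _ _ _ f j _ (locally (f t))); first exact: cfun_cont.
exact: linear_cont (incl_linear j).
Qed.

(* A curve in the smaller space, seen as a curve in the larger one. *)
Definition incl_curve {V W : Banach} (j : dense_inclusion V W) {a T : R}
  (f : Contin a T V) : Contin a T W := MkContin (@incl_cont V W j a T f).

(* Families indexed by all of R; only times t >= 0 are meaningful. *)
Record C0_semigroup {V : Banach} (S : R -> V -> V) : Prop := {
  sg_linear : forall t, 0 <= t -> is_linear (S t);
  sg_0 : forall x, S 0 x = x;
  sg_add : forall s t, 0 <= s -> 0 <= t -> forall x, S (s + t) x = S s (S t x);
  sg_cont : forall x, filterlim (fun t => S t x) (at_right 0) (locally x) }.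

(* The graph of the infinitesimal generator of S. *)
Definition generator {V : Banach} (S : R -> V -> V) (x y : V) : Prop :=
  filterlim (fun h => scal (/ h) (minus (S h x) x)) (at_right 0) (locally y).

(* A, defined on B2, generates the semigroup S on B; S restricts to the strongly
   continuous semigroup S1 on B1; B2 is an invariant core in B: it lies in the
   domain of the generator, is preserved by S, and is dense in that domain for
   the graph norm. *)
Record generates {B2 B1 B : Banach} (j2 : dense_inclusion B2 B1)
    (j1 : dense_inclusion B1 B) (A : B2 -> B)
    (S : R -> B -> B) (S1 : R -> B1 -> B1) : Prop := {
  gen_linear : is_linear A;
  gen_semigroup : C0_semigroup S;
  gen_semigroup1 : C0_semigroup S1;
  gen_restrict : forall t, 0 <= t -> forall x, j1 (S1 t x) = S t (j1 x);
  gen_generator : forall z : B2, generator S (j1 (j2 z)) (A z);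
  gen_invariant : forall t, 0 <= t ->
    forall z : B2, exists z' : B2, j1 (j2 z') = S t (j1 (j2 z));
  gen_core : forall x y : B, generator S x y -> forall eps : R, 0 < eps ->
    exists z : B2, norm (minus (j1 (j2 z)) x) < eps /\ norm (minus (A z) y) < eps }.

(* D is in L(B1,B) and, by restriction, in L(B2,B1), with norms at most 1. *)
Definition contraction_pair {B2 B1 B : Banach} (j2 : dense_inclusion B2 B1)
    (j1 : dense_inclusion B1 B) (D : B1 -> B) : Prop :=
  is_linear D /\ op_norm D <= 1 /\
  exists D' : B2 -> B1,
    (forall z, j1 (D' z) = D (j2 z)) /\ is_linear D' /\ op_norm D' <= 1.

(* For t > 0, S t takes B to B1, and its norm as an operator B -> B1 is at most
   kappa * t^(-omega) for t <= 1. *)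
Definition smoothing {B1 B : Banach} (j1 : dense_inclusion B1 B)
    (S : R -> B -> B) (kappa omega : R) : Prop :=
  exists S' : R -> B -> B1,
    (forall t, 0 < t -> forall x, j1 (S' t x) = S t x) /\
    (forall t, 0 < t <= 1 ->
       is_linear (S' t) /\ op_norm (S' t) <= kappa * Rpower t (- omega)).

Section Mild.
Variables (B1 B B1b Bb Bcon : Banach).
Variables (j : dense_inclusion B1 B) (jb : dense_inclusion B1b Bb).
Variables (n : nat) (D : 'I_n -> B1 -> B) (Db : 'I_n -> B1b -> Bb).
Variables (S : R -> B -> B) (Sb : R -> Bb -> Bb).
Variables (a T : R).
Variables (H : R -> B -> ('I_n -> B) -> Bcon -> B).
Variables (Hb : R -> Bb -> ('I_n -> Bb) -> Contin a T B -> Bb).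
Variables (u : R -> Bb -> ('I_n -> Bb) -> Bcon).

(* The integrals are Riemann integrals in B and Bb of functions that are
   continuous there. *)
Definition mild_solution (Y : B1) (Z : B1b)
    (b : Contin a T B1) (f : Contin a T B1b) : Prop :=
  let forward t s :=
    S (t - s) (H s (j (b s)) (fun i => D i (b s))
                 (u s (jb (f s)) (fun i => Db i (f s)))) in
  let backward t s :=
    Sb (s - t) (Hb s (jb (f s)) (fun i => Db i (f s)) (incl_curve j b)) in
  forall t, a <= t <= T ->
    [/\ ex_RInt (forward t) a t,
        j (b t) = plus (S (t - a) (j Y)) (RInt (forward t) a t),
        ex_RInt (backward t) t T
      & jb (f t) = minus (Sb (T - t) (jb Z)) (RInt (backward t) t T)].

End Mild.

(* Main.v *)
(* Duhamel's formula turns each equation into a fixed-point equation. Its kernel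
   e^(A(t-s)) : B -> B1 has the integrable singularity (t-s)^(-omega); substituting
   t - s = r^(q+1) with q large makes the integrand bounded, so that the
   convolution is a proper Riemann integral in B1, of norm O((T-a)^(1/(q+1))) times
   the sup-norm of the forcing in B. Since H and H^b grow linearly in (Db, D^b f),
   for T - a small every mild solution lies in the ball of radius
   2K(|Y| + |Z|); on that ball the forcings are Lipschitz, hence the
   coupled map is a contraction with factor 1/2, which yields existence,
   uniqueness and Lipschitz dependence at once. The admissible T - a depends on
   (Y,Z) only through that radius. *)
Require Import Defs.
From Stdlib Require Import Reals Lra.
From mathcomp Require Import ssreflect ssrfun ssrbool eqtype ssrnat seq fintype bigop.
From Coquelicot Require Import Coquelicot.

Set Implicit Arguments.
Unset Strict Implicit.
Unset Printing Implicit Defensive.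

Local Open Scope R_scope.

(** The obstacle is the mismatch of norms. The equations and their integrals live in the large
    spaces, but D and D^b lose one level of smoothness, so the unknowns must be controlled in B1 and
    B1b, where s -> e^(A(t-s)) g(s) may be unbounded near s = t. The integral in B1 is therefore
    built in the variable r and identified with the given one by applying the inclusion, which is
    injective and commutes with Riemann integration. Freezing the forcing separates the linear from
    the nonlinear part: the linear problem yields a single estimate, in terms of the data and the
    sup-norm of the forcing, and time reversal carries it over to the backward equation. The
    fixed-point argument uses only this estimate and treats both unknowns alike. As they evolve in
    opposite time directions, distances are taken over the whole interval and smallness comes from
    its length. The growth constant does not depend on the radius, whereas the Lipschitz constant
    does. Hence the radius can be fixed by the data before T is chosen, and uniqueness holds among
    all mild solutions. *)

(* A name for [norm (minus x y)]: over a [CompleteNormedModule], [minus] can be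
   elaborated through two different (convertible) paths, which [lra] would treat
   as distinct atoms. *)
Definition ndist {V : NormedModule R_AbsRing} (x y : V) : R := norm (minus x y).

(** * Distances, bounded linear maps and Riemann integrals *)

Section Normed.
Variable V : NormedModule R_AbsRing.
Implicit Types x y z : V.

Lemma ndist_ge0 x y : 0 <= ndist x y.
Proof. exact: norm_ge_0. Qed.

Lemma ndist_sym x y : ndist x y = ndist y x.
Proof. by rewrite /ndist -opp_minus norm_opp. Qed.

Lemma ndist_triangle x y z : ndist x z <= ndist x y + ndist y z.
Proof. by rewrite /ndist (minus_trans y); apply: norm_triangle. Qed.

Lemma ndist_eq0 x y : ndist x y <= 0 -> x = y.
Proof.
move=> h; have h0 : ndist x y = 0 by have := ndist_ge0 x y; lra.
have := norm_eq_zero _ h0 => {}h0.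
by rewrite -[x]plus_zero_r -(plus_opp_l y) plus_assoc -/(minus x y) h0 plus_zero_l.
Qed.

Lemma ndist_zero x : ndist x zero = norm x.
Proof. by rewrite /ndist minus_zero_r. Qed.

Lemma ndist_self x : ndist x x = 0.
Proof. by rewrite /ndist minus_eq_zero norm_zero. Qed.

Lemma ndist_plus x x' y y' :
  ndist (plus x y) (plus x' y') <= ndist x x' + ndist y y'.
Proof.
have -> : ndist (plus x y) (plus x' y') = norm (plus (minus x x') (minus y y')).
  rewrite /ndist /minus opp_plus -!plus_assoc; congr (norm (plus _ _)).
  by rewrite !plus_assoc; congr plus; rewrite plus_comm.
exact: norm_triangle.
Qed.

Lemma ndist_opp x y : ndist (opp x) (opp y) = ndist x y.
Proof.
by rewrite ndist_sym /ndist /minus opp_opp plus_comm.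
Qed.

Lemma norm_le_ndist x y : norm x <= norm y + ndist x y.
Proof. by have := ndist_triangle x y zero; rewrite !ndist_zero; lra. Qed.

Lemma continuous_epsP (f : R -> V) t : continuous f t <->
  forall eps, 0 < eps -> exists d, 0 < d /\
    forall s, Rabs (s - t) < d -> ndist (f s) (f t) < eps.
Proof.
split=> [/filterlim_locally_ball_norm h eps eps0|h].
  by case: (h (mkposreal _ eps0)) => d hd; exists d; split; [apply: cond_pos | apply: hd].
apply/filterlim_locally_ball_norm => eps.
have [d [d0 hd]] := h _ (cond_pos eps).
by exists (mkposreal _ d0) => s; apply: hd.
Qed.

End Normed.

Lemma ndist_R (x y : R) : ndist x y = Rabs (x - y).
Proof. by []. Qed.

Section Linear.
Variables (V W : NormedModule R_AbsRing) (l : V -> W).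
Hypothesis l_lin : is_linear l.

Lemma ndist_linear x y : ndist (l x) (l y) = norm (l (minus x y)).
Proof. by rewrite (linear_minus _ _ _ l_lin). Qed.

(** Boundedness, part of [is_linear], makes the supremum finite, so [real] returns it; homogeneity
    extends the bound from the unit ball, with vectors of norm 0 apart because of the division. *)
Lemma op_norm_le x : norm (l x) <= op_norm l * norm x.
Proof.
have [C [C0 hC]] := linear_norm _ l_lin.
set E := fun r => exists x : V, norm x <= 1 /\ r = norm (l x).
have [ub lub] := Lub_Rbar_correct E.
have le1 y : norm y <= 1 -> norm (l y) <= op_norm l.
  move=> y1.
  have hy : Rbar_le (norm (l y)) (Lub_Rbar E) by apply: ub; exists y.
  have hCl : Rbar_le (Lub_Rbar E) C.
    apply: lub => r [z [z1 ->]] /=; apply: Rle_trans (hC z) _.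
    have := norm_ge_0 z; nra.
  by move: hy hCl; rewrite /op_norm -/E; case: (Lub_Rbar E).
case: (Rle_lt_dec (norm x) 0) => x0.
  have nx : norm x = 0 by have := norm_ge_0 x; lra.
  by rewrite (norm_eq_zero _ nx) (linear_zero _ l_lin) !norm_zero; lra.
have -> : l x = scal (norm x) (l (scal (/ norm x) x)).
  by rewrite -(linear_scal _ l_lin) scal_assoc /mult /= Rinv_r ?scal_one //; lra.
apply: Rle_trans (norm_scal _ _) _; rewrite /abs /= Rabs_right; last lra.
rewrite Rmult_comm; apply: Rmult_le_compat_r; first lra.
apply: le1; apply: Rle_trans (norm_scal _ _) _; rewrite /abs /= Rabs_right.
  by rewrite Rinv_l; lra.
by apply: Rle_ge; apply: Rlt_le; apply: Rinv_0_lt_compat.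
Qed.

Lemma Riemann_sum_linear (f : R -> V) ptd :
  Riemann_sum (fun t => l (f t)) ptd = l (Riemann_sum f ptd).
Proof.
elim/(@SF_cons_ind R): ptd => [x0|h s IH]; first by rewrite /Riemann_sum /= (linear_zero _ l_lin).
by rewrite !Riemann_sum_cons IH (linear_plus _ l_lin) (linear_scal _ l_lin).
Qed.

Lemma is_RInt_linear (f : R -> V) a b If :
  is_RInt f a b If -> is_RInt (fun t => l (f t)) a b (l If).
Proof.
move=> h.
apply: (filterlim_ext (fun ptd => l (scal (sign (b - a)) (Riemann_sum f ptd)))).
  by move=> ptd; rewrite (linear_scal _ l_lin) Riemann_sum_linear.
apply: filterlim_comp h _; exact: linear_cont.
Qed.

End Linear.

Lemma ndist_incl (V W : Banach) (j : dense_inclusion V W) x y :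
  ndist (j x) (j y) <= ndist x y.
Proof. by rewrite (ndist_linear (incl_linear j)); apply: incl_norm. Qed.

(** * Continuous curves on [a,T] and the sup-norm distance *)

Section Contin.
Variables (a T : R) (aT : a <= T).

(** The retraction of the line onto [a,T]. Curves carry junk outside [a,T]; composed with it they
    become continuous everywhere, free of side conditions. *)
Definition clamp (t : R) : R := Rmax a (Rmin T t).

Lemma clamp_in t : a <= clamp t <= T.
Proof. by rewrite /clamp /Rmax /Rmin; do !case: Rle_dec; lra. Qed.

Lemma clamp_id t : a <= t <= T -> clamp t = t.
Proof. by rewrite /clamp /Rmax /Rmin; do !case: Rle_dec; lra. Qed.

Lemma clamp_lip s t : Rabs (clamp s - clamp t) <= Rabs (s - t).
Proof.
have h1 := Rle_abs (s - t); have := Rle_abs (- (s - t)); rewrite Rabs_Ropp => h2.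
by apply: Rabs_le; rewrite /clamp /Rmax /Rmin; do !case: Rle_dec; lra.
Qed.

Lemma clamp_continuous (V : UniformSpace) (f : Contin a T V) t :
  continuous (fun s => f (clamp s)) t.
Proof.
have h := @cfun_cont _ _ _ f _ (clamp_in t).
refine (filterlim_comp _ _ _ clamp f _ _ _ _ h).
move=> P [d hd]; exists d => s hs; apply: hd; last exact: clamp_in.
exact: Rle_lt_trans (clamp_lip _ _) hs.
Qed.

Lemma continuous_on_all (V : UniformSpace) (g : R -> V) (P : R -> Prop) :
  (forall t, continuous g t) -> continuous_on P g.
Proof.
by move=> h t _; apply: (filterlim_filter_le_1 _ (filter_le_within _)); apply: h.
Qed.

Variable V : NormedModule R_AbsRing.
Implicit Types f g h : Contin a T V.

Lemma Contin_bounded f g :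
  exists C, forall t, a <= t <= T -> ndist (f t) (g t) <= C.
Proof.
pose k t := ndist (f (clamp t)) (g (clamp t)).
have k_cont c : continuity_pt k c.
  apply/continuity_pt_filterlim.
  apply: (continuous_comp (fun t => minus (f (clamp t)) (g (clamp t))) norm).
    by apply: continuous_minus; apply: clamp_continuous.
  exact: filterlim_norm.
have [x [hx _]] := continuity_ab_maj k a T aT (fun c _ => k_cont c).
by exists (k x) => t ht; have := hx t ht; rewrite {1}/k clamp_id.
Qed.

Lemma le_Cdist f g t : a <= t <= T -> ndist (f t) (g t) <= Cdist f g.
Proof.
move=> ht.
have [C hC] := Contin_bounded f g.
rewrite /Cdist; set E := (fun r => _); have [ub lub] := Lub_Rbar_correct E.
have h1 : Rbar_le (ndist (f t) (g t)) (Lub_Rbar E) by apply: ub; exists t.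
have h2 : Rbar_le (Lub_Rbar E) C by apply: lub => r [s [hs ->]]; apply: hC.
by move: h1 h2; case: (Lub_Rbar E).
Qed.

(** Here [a <= T] matters: over an empty interval the supremum is -oo, which [real] turns into 0
    whatever [c] is. *)
Lemma Cdist_le f g c :
  (forall t, a <= t <= T -> ndist (f t) (g t) <= c) -> Cdist f g <= c.
Proof.
move=> hc; have h1 := le_Cdist f g (conj (Rle_refl a) aT).
move: h1; rewrite /Cdist; set E := (fun r => _); have [ub lub] := Lub_Rbar_correct E.
have h2 : Rbar_le (Lub_Rbar E) c by apply: lub => r [s [hs ->]]; apply: hc.
have h3 : Rbar_le (ndist (f a) (g a)) (Lub_Rbar E).
  by apply: ub; exists a; split=> //; lra.
by move: h2 h3; case: (Lub_Rbar E).
Qed.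

Lemma Cdist_ge0 f g : 0 <= Cdist f g.
Proof.
exact: Rle_trans (norm_ge_0 _) (le_Cdist f g (conj (Rle_refl a) aT)).
Qed.

Lemma Cdist_sym f g : Cdist f g = Cdist g f.
Proof.
by apply: Rle_antisym; apply: Cdist_le => t ht; rewrite ndist_sym; apply: le_Cdist.
Qed.

Lemma Cdist_triangle f g h : Cdist f h <= Cdist f g + Cdist g h.
Proof.
apply: Cdist_le => t ht; apply: Rle_trans (ndist_triangle _ (g t) _) _.
by apply: Rplus_le_compat; apply: le_Cdist.
Qed.

End Contin.

(** * Strongly continuous semigroups *)

Section Semigroup.
Variables (V : Banach) (S : R -> V -> V) (M m : R).
Hypothesis S_sg : C0_semigroup S.
Hypotheses (M_ge0 : 0 <= M) (m_ge0 : 0 <= m).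
Hypothesis S_bound : forall t, 0 <= t -> op_norm (S t) <= M * exp (m * t).

Lemma sg_norm_le (K t : R) x : 0 <= t <= K -> norm (S t x) <= M * exp (m * K) * norm x.
Proof.
move=> [t0 tK]; apply: Rle_trans (op_norm_le (sg_linear S_sg t0) x) _.
apply: Rmult_le_compat_r; first exact: norm_ge_0.
apply: Rle_trans (S_bound t0) _; apply: Rmult_le_compat_l => //.
case: (Req_dec (m * t) (m * K)) => [->|ne]; first exact: Rle_refl.
apply: Rlt_le; apply: exp_increasing; nra.
Qed.

(** For [s <= t] the difference is [S s] applied to S (t - s) x - x, so right continuity at 0
    controls both one-sided limits at every time. *)
Lemma sg_norm_diff_le (K s t : R) x : 0 <= s <= K -> 0 <= t <= K ->
  ndist (S t x) (S s x) <= M * exp (m * K) * ndist (S (Rabs (t - s)) x) x.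
Proof.
wlog st : s t / s <= t => [wl hs ht|hs ht].
  case: (Rle_dec s t) => st; first exact: wl.
  rewrite ndist_sym Rabs_minus_sym; apply: wl => //; lra.
rewrite Rabs_right; last lra.
have -> : S t x = S s (S (t - s) x) by rewrite -(sg_add S_sg); [congr (S _ x) | |]; lra.
by rewrite (ndist_linear (sg_linear S_sg hs.1)); apply: sg_norm_le.
Qed.

Lemma sg_small x eps : 0 < eps ->
  exists d, 0 < d /\ forall h, 0 <= h < d -> ndist (S h x) x < eps.
Proof.
move=> eps0.
have [d hd] := (proj1 (filterlim_locally_ball_norm _ _) (@sg_cont _ _ S_sg x)) (mkposreal _ eps0).
exists d; split=> [|h [h0 hh]]; first exact: cond_pos.
case: h0 => h0; last by rewrite -h0 (sg_0 S_sg) ndist_self.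
by apply: hd => //; rewrite /ball /= /AbsRing_ball /abs /minus /plus /opp /= Rabs_right; lra.
Qed.

(** Joint strong continuity, from norm bounds uniform on bounded times. [Rmax 0] avoids negative
    times, where [S] is arbitrary. *)
Lemma sg_comp_continuous (h : R -> R) (k : R -> V) t :
  continuous h t -> continuous k t -> continuous (fun s => S (Rmax 0 (h s)) (k s)) t.
Proof.
move=> /continuous_epsP hh /continuous_epsP hk; apply/continuous_epsP => eps eps0; cbv beta.
set p := Rmax 0 (h t); have p0 : 0 <= p by apply: Rmax_l.
(* [P - 1] bounds the norms up to time [p + 1], beyond which the nearby times do not go; the extra 1
   keeps [P] positive when [M] is 0. *)
set P := M * exp (m * (p + 1)) + 1.
have P0 : 0 < P by have := exp_pos (m * (p + 1)); rewrite /P; nra.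
have e20 : 0 < eps / 2 / P by apply: Rdiv_lt_0_compat; lra.
have [d3 [d30 h3]] := sg_small (k t) e20.
have [d1 [d10 h1]] := hh (Rmin 1 d3) (Rmin_pos _ _ Rlt_0_1 d30).
have [d2 [d20 h2]] := hk _ e20.
exists (Rmin d1 d2); split=> [|s hs]; first exact: Rmin_pos.
have {}h1 := h1 s (Rlt_le_trans _ _ _ hs (Rmin_l _ _)).
have {}h2 := h2 s (Rlt_le_trans _ _ _ hs (Rmin_r _ _)).
set q := Rmax 0 (h s); have q0 : 0 <= q by apply: Rmax_l.
have pq : Rabs (q - p) < Rmin 1 d3.
  apply: Rle_lt_trans h1; rewrite ndist_R.
  have e1 := Rle_abs (h s - h t); have := Rle_abs (- (h s - h t)); rewrite Rabs_Ropp => e2.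
  by apply: Rabs_le; rewrite /p /q /Rmax; do !case: Rle_dec; lra.
have qp1 : q <= p + 1.
  have := Rlt_le_trans _ _ _ pq (Rmin_l _ _); have := Rle_abs (q - p); lra.
apply: Rle_lt_trans (ndist_triangle _ (S q (k t)) _) _.
have e1 : ndist (S q (k s)) (S q (k t)) <= (P - 1) * ndist (k s) (k t).
  rewrite (ndist_linear (sg_linear S_sg q0)) /P; ring_simplify (M * exp (m * (p + 1)) + 1 - 1).
  exact: sg_norm_le.
have e2 : ndist (S q (k t)) (S p (k t)) <=
    (P - 1) * ndist (S (Rabs (q - p)) (k t)) (k t).
  rewrite /P; ring_simplify (M * exp (m * (p + 1)) + 1 - 1).
  by apply: sg_norm_diff_le; split; lra.
have e3 := h3 _ (conj (Rabs_pos _) (Rlt_le_trans _ _ _ pq (Rmin_r _ _))).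
have -> : eps = P * (eps / 2 / P) + P * (eps / 2 / P) by field; lra.
have P1 : 0 <= P - 1.
  by have := Rmult_le_pos _ _ M_ge0 (Rlt_le _ _ (exp_pos (m * (p + 1)))); rewrite /P; lra.
have := Rmult_le_compat_l _ _ _ P1 (Rlt_le _ _ h2).
have := Rmult_le_compat_l _ _ _ P1 (Rlt_le _ _ e3); lra.
Qed.

End Semigroup.

(** * The root of order p + 1 and its modulus of continuity *)

Section Root.
Variable p : nat.

(** The case [x <= 0] is apart because [ln] has the default value 0 there, which would make
    [Rpower 0 _] equal to 1. *)
Definition root (x : R) : R :=
  if Rle_dec x 0 then 0 else Rpower x (/ INR p.+1).

Lemma root_ge0 x : 0 <= root x.
Proof. rewrite /root; case: Rle_dec => h; [exact: Rle_refl | exact: Rlt_le (exp_pos _)]. Qed.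

Lemma root_pow x : 0 <= x -> root x ^ p.+1 = x.
Proof.
move=> x0; rewrite /root; case: Rle_dec => hx.
  by rewrite /= Rmult_0_l; lra.
rewrite -Rpower_pow; last exact: exp_pos.
rewrite Rpower_mult Rinv_l ?Rpower_1 //; [lra | exact: not_0_INR].
Qed.

(** Superadditivity of the power makes the root Hölder continuous with constant 1, down to 0. *)
Lemma pow_superadd u v : 0 <= v <= u -> (u - v) ^ p.+1 + v ^ p.+1 <= u ^ p.+1.
Proof.
move=> huv; elim: p => [|k IH]; first by rewrite /=; lra.
have hv : 0 <= v ^ k.+1 by apply: pow_le; lra.
have hu : 0 <= (u - v) ^ k.+1 by apply: pow_le; lra.
move: IH hv hu; rewrite -!(tech_pow_Rmult _ k.+1).
move: (v ^ k.+1) (u ^ k.+1) ((u - v) ^ k.+1) => y x z *; nra.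
Qed.

Lemma pow_lt_inv u v : 0 <= u -> 0 <= v -> u ^ p.+1 < v ^ p.+1 -> u < v.
Proof.
move=> u0 v0 h; apply: Rnot_le_lt => vu.
have := pow_incr v u p.+1 (conj v0 vu); lra.
Qed.

Lemma root_diff_lt x y d : 0 <= x -> 0 <= y -> 0 < d ->
  Rabs (x - y) < d ^ p.+1 -> Rabs (root x - root y) < d.
Proof.
wlog yx : x y / root y <= root x => [wl x0 y0 d0 h|x0 y0 d0 h].
  case: (Rle_dec (root y) (root x)) => yx; first exact: wl.
  by rewrite Rabs_minus_sym; apply: wl => //; [lra | rewrite Rabs_minus_sym].
rewrite Rabs_right; last lra.
apply: pow_lt_inv; [lra | lra |].
have := pow_superadd (conj (root_ge0 y) yx); rewrite !root_pow // => h2.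
have := Rle_abs (x - y); lra.
Qed.

Lemma root_lt x d : 0 <= x -> 0 <= d -> x < d ^ p.+1 -> root x < d.
Proof. by move=> x0 d0 h; apply: pow_lt_inv; rewrite ?root_pow //; apply: root_ge0. Qed.

Lemma root_le x d : 0 <= x -> 0 <= d -> x <= d ^ p.+1 -> root x <= d.
Proof.
move=> x0 d0 h; apply: Rnot_lt_le => dr.
have := pow_superadd (conj d0 (Rlt_le _ _ dr)); rewrite root_pow //.
have := pow_lt (root x - d) p.+1; lra.
Qed.

Lemma root_le_root x y : 0 <= x <= y -> root x <= root y.
Proof. by move=> h; apply: root_le; rewrite ?root_pow; try lra; apply: root_ge0. Qed.

End Root.

(** * Weakly singular convolutions *)

Lemma is_RInt_reflect (V : NormedModule R_AbsRing) (f : R -> V) c a b l :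
  is_RInt f (c - b) (c - a) l -> is_RInt (fun s => f (c - s)) a b l.
Proof.
move=> h.
have h1 : is_RInt f (-1 * a + c) (-1 * b + c) (opp l).
  have -> : -1 * a + c = c - a by ring.
  have -> : -1 * b + c = c - b by ring.
  exact: is_RInt_swap.
have := is_RInt_opp _ _ _ _ (is_RInt_comp_lin _ _ _ _ _ _ h1).
rewrite opp_opp; apply: is_RInt_ext => s _.
have -> : -1 * s + c = c - s by ring.
by rewrite -(scal_opp_one (scal _ _)) scal_assoc /mult /= /opp /one /= -[RHS]scal_one;
  congr scal; ring_simplify.
Qed.

(* [W r x] is the integrand of [int_0^(rho^(q+1)) e^(At) x dt] after the
   substitution t = r^(q+1); for q large it absorbs the singularity t^(-omega). *)
Record smooth_kernel (B1 B : Banach) (j : dense_inclusion B1 B) (S : R -> B -> B)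
    (q : nat) (C : R) (W : R -> B -> B1) : Prop := {
  sk_incl : forall r x, 0 <= r -> j (W r x) = scal (INR q.+1 * r ^ q) (S (r ^ q.+1) x);
  sk_zero : forall r, 0 <= r -> W r zero = zero;
  sk_lip : forall r x y, 0 <= r <= 1 -> ndist (W r x) (W r y) <= C * ndist x y;
  sk_cont : forall k : R -> B, (forall r, continuous k r) ->
    forall r, continuous (fun r => W r (k r)) r }.

(** The exponent of [r] is (q+1)(1 - omega) - 1 >= 1, and [r <= 1]. The bound 2 instead of 1 buys
    the factor [r], by which the kernel vanishes at 0 instead of staying merely bounded. *)
Lemma pow_Rpower_le (q : nat) (omega r : R) : 2 <= INR q.+1 * (1 - omega) ->
  0 < r <= 1 -> r ^ q * Rpower (r ^ q.+1) (- omega) <= r.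
Proof.
move=> hq [r0 r1].
rewrite -!Rpower_pow // Rpower_mult -Rpower_plus -[X in _ <= X](Rpower_1 r) // /Rpower.
have lr : ln r <= 0.
  case: (Req_dec r 1) => [->|ne]; first by rewrite ln_1; lra.
  by rewrite -ln_1; apply/Rlt_le/ln_increasing; lra.
have : (INR q + INR q.+1 * - omega) * ln r <= 1 * ln r by move: hq; rewrite S_INR; nra.
by case=> [/exp_increasing/Rlt_le //|->]; exact: Rle_refl.
Qed.

Section Kernel.
Variables (B1 B : Banach) (j : dense_inclusion B1 B).
Variables (S : R -> B -> B) (S1 : R -> B1 -> B1) (M1 m1 kappa omega : R).
Hypotheses (S_sg : C0_semigroup S) (S1_sg : C0_semigroup S1).
Hypotheses (M1_ge0 : 0 <= M1) (m1_ge0 : 0 <= m1).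
Hypothesis S1_bound : forall t, 0 <= t -> op_norm (S1 t) <= M1 * exp (m1 * t).
Hypothesis S_restrict : forall t, 0 <= t -> forall x, j (S1 t x) = S t (j x).
Hypothesis kappa_gt0 : 0 < kappa.
Hypothesis S_smooth : smoothing j S kappa omega.

(** Smoothing bounds each [S' t] but says nothing on continuity in [t] with values in [B1]. That
    comes from the factorization S' t = S1 (t - t0) S' t0 with [t0] fixed, checked after the
    injective inclusion. *)
Lemma smoothing_continuous (S' : R -> B -> B1) (h : R -> R) (k : R -> B) r :
  (forall t, 0 < t -> forall x, j (S' t x) = S t x) ->
  (forall t, 0 < t <= 1 -> is_linear (S' t)) ->
  continuous h r -> continuous k r -> 0 < h r ->
  continuous (fun s => S' (h s) (k s)) r.
Proof.
move=> S'S S'lin hc kc hr.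
(* At most 1, so that [S' t0] is known to be linear; at most half of [h r], so that [h s - t0] stays
   positive for [s] near [r]. *)
pose t0 := Rmin 1 (h r / 2).
have t0_gt0 : 0 < t0 by apply: Rmin_pos; lra.
have t0_le : t0 <= h r / 2 by apply: Rmin_r.
apply: (continuous_ext_loc _ (fun s => S1 (Rmax 0 (h s - t0)) (S' t0 (k s)))).
  have [d [d0 hd]] := proj1 (continuous_epsP _ _) hc _ t0_gt0.
  exists (mkposreal _ d0) => s /hd; rewrite ndist_R => /Rabs_def2 hs.
  apply: (incl_inj (d := j)); rewrite Rmax_right; last lra.
  rewrite S_restrict; last lra.
  by rewrite !S'S -?(sg_add S_sg); try lra; congr (S _ (k s)); lra.
apply: (sg_comp_continuous (M := M1) (m := m1)) => //.
  exact: continuous_minus hc (continuous_const _ _).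
apply: continuous_comp kc _; apply: linear_cont; apply: S'lin; split=> //; exact: Rmin_l.
Qed.

Lemma smooth_kernel_exists (q : nat) : 2 <= INR q.+1 * (1 - omega) ->
  0 <= omega -> exists W, smooth_kernel j S q (INR q.+1 * kappa) W.
Proof.
move=> hq omega0; have [S' [S'S S'b]] := S_smooth.
(* Makes the factor [r ^ q] vanish at 0, in agreement with the value [zero] given to [W] there. *)
have q1 : q <> 0%nat by move=> q0; move: hq; rewrite q0 /=; lra.
pose W r x := if Rle_dec r 0 then zero else scal (INR q.+1 * r ^ q) (S' (r ^ q.+1) x).
have W0 r x : r <= 0 -> W r x = zero by rewrite /W; case: Rle_dec.
have W1 r x : 0 < r -> W r x = scal (INR q.+1 * r ^ q) (S' (r ^ q.+1) x).
  by rewrite /W; case: Rle_dec => // *; exfalso; lra.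
have Q0 : 0 < INR q.+1 by exact: lt_0_INR (Nat.lt_0_succ _).
have Wzero r : 0 <= r -> W r zero = zero.
  case=> [r0|<-]; last by rewrite W0 //; exact: Rle_refl.
  rewrite W1 //; have p0 := pow_lt r q.+1 r0.
  have -> : S' (r ^ q.+1) zero = zero; last exact: scal_zero_r.
  apply: (incl_inj (d := j)); rewrite S'S // (linear_zero _ (incl_linear j)).
  by rewrite linear_zero //; apply: (sg_linear S_sg); lra.
(* Sharper than [sk_lip] by the factor [r]: this gives continuity at 0, as [k] is bounded near 0. *)
have Wlip r x y : 0 <= r <= 1 -> ndist (W r x) (W r y) <= INR q.+1 * kappa * r * ndist x y.
  case=> -[r0|<-] r1; last by rewrite !W0 ?ndist_self; lra.
  have p01 : 0 < r ^ q.+1 <= 1.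
    by split; [exact: pow_lt | rewrite -(pow1 q.+1); apply: pow_incr; lra].
  have [lin bd] := S'b _ p01.
  rewrite !W1 // /ndist -scal_minus_distr_l -(linear_minus _ _ _ lin).
  apply: Rle_trans (norm_scal _ _) _; rewrite /abs /= Rabs_right; last first.
    by apply/Rle_ge/Rlt_le/Rmult_lt_0_compat => //; exact: pow_lt.
  have h1 := op_norm_le lin (minus x y).
  have h2 := pow_Rpower_le hq (conj r0 r1).
  have rq := pow_lt r q r0.
  rewrite -/(ndist x y) in h1 *; have d0 := ndist_ge0 x y.
  have h3 := Rle_trans _ _ _ h1 (Rmult_le_compat_r _ _ _ d0 bd).
  apply: Rle_trans (Rmult_le_compat_l _ _ _ _ h3) _; first by apply/Rlt_le/Rmult_lt_0_compat.
  have -> : INR q.+1 * r ^ q * (kappa * Rpower (r ^ q.+1) (- omega) * ndist x y)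
    = INR q.+1 * kappa * (r ^ q * Rpower (r ^ q.+1) (- omega)) * ndist x y by ring.
  apply: Rmult_le_compat_r => //; apply: Rmult_le_compat_l => //.
  by apply/Rlt_le/Rmult_lt_0_compat.
exists W; split=> //.
- move=> r x [r0|<-].
    by rewrite W1 // (linear_scal _ (incl_linear j)) S'S //; exact: pow_lt.
  have q_gt0 : (0 < q)%coq_nat by apply/ltP; rewrite lt0n; apply/eqP.
  rewrite W0 ?(pow_i q) //; last exact: Rle_refl.
  by rewrite Rmult_0_r scal_zero_l (linear_zero _ (incl_linear j)).
- move=> r x y r01; apply: Rle_trans (Wlip r x y r01) _.
  have : 0 <= INR q.+1 * kappa * ndist x y.
    by apply: Rmult_le_pos (ndist_ge0 _ _); apply/Rlt_le/Rmult_lt_0_compat.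
  nra.
move=> k kc r; case: (Rtotal_order r 0) => [r0|[->|r0]].
- apply: (continuous_ext_loc _ (fun _ : R => zero : B1)); last exact: continuous_const.
  have r'0 : 0 < - r by lra.
  exists (mkposreal _ r'0) => s /Rabs_def2 /= hs; rewrite W0 //.
  move: hs; rewrite /minus /plus /opp /=; lra.
- apply/continuous_epsP => eps eps0; cbv beta.
  have [d [d0 hd]] := proj1 (continuous_epsP _ _) (kc 0) 1 Rlt_0_1.
  pose c := INR q.+1 * kappa * (norm (k 0) + 1) + 1.
  have c0 : 0 < c.
    have : 0 < INR q.+1 * kappa by exact: Rmult_lt_0_compat.
    have := norm_ge_0 (k 0); rewrite /c; nra.
  exists (Rmin d (Rmin 1 (eps / c))); split.
    by do 2?apply: Rmin_pos => //; [lra | exact: Rdiv_lt_0_compat].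
  move=> s; rewrite Rminus_0_r => hs.
  have hs1 := Rlt_le_trans _ _ _ hs (Rmin_l _ _).
  have hs2 := Rlt_le_trans _ _ _ (Rlt_le_trans _ _ _ hs (Rmin_r _ _)) (Rmin_l _ _).
  have hs3 := Rlt_le_trans _ _ _ (Rlt_le_trans _ _ _ hs (Rmin_r _ _)) (Rmin_r _ _).
  rewrite (W0 0); last lra.
  case: (Rle_dec s 0) => s0; first by rewrite W0 ?ndist_self.
  rewrite Rabs_right in hs1 hs2 hs3; try lra.
  rewrite -(Wzero s); last lra.
  apply: Rle_lt_trans (Wlip s _ _ _) _; first lra.
  rewrite ndist_zero.
  have k1 : norm (k s) <= norm (k 0) + 1.
    have := norm_le_ndist (k s) (k 0); have := hd s; rewrite Rminus_0_r Rabs_right; lra.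
  have -> : eps = c * (eps / c) by field; lra.
  have qk : 0 < INR q.+1 * kappa by exact: Rmult_lt_0_compat.
  have e1 : INR q.+1 * kappa * norm (k s) <= c.
    by rewrite /c; have := Rmult_le_compat_l _ _ _ (Rlt_le _ _ qk) k1; lra.
  have -> : INR q.+1 * kappa * s * norm (k s) = INR q.+1 * kappa * norm (k s) * s by ring.
  apply: Rle_lt_trans (Rmult_le_compat_r _ _ _ _ e1) _; first lra.
  exact: Rmult_lt_compat_l.
- apply: (continuous_ext_loc _ (fun s => scal (INR q.+1 * s ^ q) (S' (s ^ q.+1) (k s)))).
    exists (mkposreal _ r0) => s /Rabs_def2 /= hs; rewrite W1 //.
    move: hs; rewrite /minus /plus /opp /=; lra.
  have pc p : continuous (fun s : R => s ^ p) r.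
    by apply/continuity_pt_filterlim/derivable_continuous_pt/derivable_pt_pow.
  apply: continuous_scal.
    apply: (continuous_mult (fun=> INR q.+1)); [exact: continuous_const | exact: pc].
  apply: smoothing_continuous => //; first by move=> t /S'b [].
  exact: pow_lt.
Qed.

End Kernel.

(** * Duhamel's formula for a prescribed forcing, forward and backward in time *)

Section Duhamel.
Variables (B1 B : Banach) (j : dense_inclusion B1 B).
Variables (S : R -> B -> B) (S1 : R -> B1 -> B1) (M m M1 m1 : R).
Hypotheses (S_sg : C0_semigroup S) (S1_sg : C0_semigroup S1).
Hypotheses (M_ge0 : 0 <= M) (m_ge0 : 0 <= m) (M1_ge0 : 0 <= M1) (m1_ge0 : 0 <= m1).
Hypothesis S_bound : forall t, 0 <= t -> op_norm (S t) <= M * exp (m * t).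
Hypothesis S1_bound : forall t, 0 <= t -> op_norm (S1 t) <= M1 * exp (m1 * t).
Hypothesis S_restrict : forall t, 0 <= t -> forall x, j (S1 t x) = S t (j x).
Variables (q : nat) (C : R) (W : R -> B -> B1).
Hypotheses (C_ge0 : 0 <= C) (W_kernel : smooth_kernel j S q C W).

(** The [B1]-valued form of the integral of S t (k t) over [0, rho^(q+1)], in the variable r with t
    = r^(q+1). *)
Definition conv (k : R -> B) (rho : R) : B1 := RInt (fun r => W r (k (r ^ q.+1))) 0 rho.

Section Conv.
Variables k k' : R -> B.
Hypotheses (k_cont : forall t, continuous k t) (k'_cont : forall t, continuous k' t).

Lemma pow_continuous (p : nat) r : continuous (fun s : R => s ^ p) r.
Proof. by apply/continuity_pt_filterlim/derivable_continuous_pt/derivable_pt_pow. Qed.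

Lemma ex_conv x y : ex_RInt (fun r => W r (k (r ^ q.+1))) x y.
Proof.
apply: ex_RInt_continuous => r _; apply: (sk_cont W_kernel (k := fun r => k (r ^ q.+1))) => s.
by apply: (continuous_comp (fun s => s ^ q.+1) k); [exact: pow_continuous | exact: k_cont].
Qed.

(** The substitution is made in [B], where the integrand is continuous up to 0; there the inclusion
    of the [B1]-integrand equals the transformed one. *)
Lemma is_RInt_conv rho : 0 <= rho ->
  is_RInt (fun t => S (Rmax 0 t) (k t)) 0 (rho ^ q.+1) (j (conv k rho)).
Proof.
move=> rho0; set f := fun t => _.
have f_cont t : continuous f t.
  apply: (sg_comp_continuous S_sg M_ge0 m_ge0 S_bound (h := fun t => t)).
    exact: continuous_id.
  exact: k_cont.
have h1 : is_RInt f 0 (rho ^ q.+1) (RInt f 0 (rho ^ q.+1)).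
  by apply: RInt_correct; apply: ex_RInt_continuous => t _; apply: f_cont.
have h2 : is_RInt (fun r => scal (INR q.+1 * r ^ q) (f (r ^ q.+1))) 0 rho
    (RInt f (0 ^ q.+1) (rho ^ q.+1)).
  apply: (is_RInt_comp f (fun r => r ^ q.+1) (fun r => INR q.+1 * r ^ q)) => [r _|r _].
    exact: f_cont.
  split; last first.
    apply: (continuous_mult (fun=> INR q.+1)); [exact: continuous_const | exact: pow_continuous].
  have := is_derive_pow id q.+1 r 1 (is_derive_id _).
  by rewrite Rmult_1_r.
rewrite pow_i in h2; last exact: Nat.lt_0_succ.
suff -> : j (conv k rho) = RInt f 0 (rho ^ q.+1) by [].
have h3 := is_RInt_linear (incl_linear j) (RInt_correct _ _ _ (ex_conv 0 rho)).
rewrite -(is_RInt_unique _ _ _ _ h3) -(is_RInt_unique _ _ _ _ h2).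
apply: RInt_ext => r; rewrite Rmin_left // => -[r0 _].
rewrite (sk_incl W_kernel); last lra.
by rewrite /f Rmax_right //; apply/pow_le; lra.
Qed.

(** The factor [rho], the length of the interval in the variable r, is the source of all smallness.
    It must not exceed 1, the range of the kernel bound. *)
Lemma ndist_conv e rho : 0 <= rho <= 1 ->
  (forall t, 0 <= t <= rho ^ q.+1 -> ndist (k t) (k' t) <= e) ->
  ndist (conv k rho) (conv k' rho) <= C * e * rho.
Proof.
move=> [rho0 rho1] he.
have -> : C * e * rho = (rho - 0) * (C * e) by ring.
have k'c x y : ex_RInt (fun r => W r (k' (r ^ q.+1))) x y.
  apply: ex_RInt_continuous => r _; apply: (sk_cont W_kernel (k := fun r => k' (r ^ q.+1))) => s.
  by apply: (continuous_comp (fun s => s ^ q.+1) k'); [exact: pow_continuous | exact: k'_cont].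
apply: (norm_RInt_le_const _ _ _ _ _ rho0 _
  (is_RInt_minus _ _ _ _ _ _ (RInt_correct _ _ _ (ex_conv 0 rho))
    (RInt_correct _ _ _ (k'c 0 rho)))).
move=> r [r0 r1].
apply: Rle_trans (sk_lip W_kernel _ _ _) _; first by split; lra.
apply: Rmult_le_compat_l => //; apply: he.
by split; [exact: pow_le | apply: pow_incr; lra].
Qed.

(** Comparison with [W r zero] turns the Lipschitz bound into a norm bound on the added piece of the
    integral. *)
Lemma ndist_conv_bound e rho rho' : 0 <= rho <= 1 -> 0 <= rho' <= 1 ->
  (forall t, 0 <= t <= 1 -> norm (k t) <= e) ->
  ndist (conv k rho') (conv k rho) <= C * e * Rabs (rho' - rho).
Proof.
wlog rr : rho rho' / rho <= rho' => [wl h1 h2 he|[h1 h2] [h3 h4] he].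
  case: (Rle_dec rho rho') => rr; first exact: wl.
  by rewrite ndist_sym Rabs_minus_sym; apply: wl => //; lra.
have i1 := RInt_correct _ _ _ (ex_conv 0 rho).
have i2 := RInt_correct _ _ _ (ex_conv rho rho').
have -> : conv k rho' = plus (conv k rho) (RInt (fun r => W r (k (r ^ q.+1))) rho rho').
  by apply: is_RInt_unique; apply: is_RInt_Chasles i1 i2.
have -> : ndist (plus (conv k rho) (RInt (fun r => W r (k (r ^ q.+1))) rho rho')) (conv k rho)
    = norm (RInt (fun r => W r (k (r ^ q.+1))) rho rho').
  rewrite /ndist /minus; congr norm.
  by rewrite plus_comm plus_assoc plus_opp_l plus_zero_l.
rewrite Rabs_right; last lra.
rewrite Rmult_comm; apply: norm_RInt_le_const rr _ i2 => r [r0 r1].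
rewrite -ndist_zero -(sk_zero W_kernel (r := r)); last lra.
apply: Rle_trans (sk_lip W_kernel _ _ _) _; first by split; lra.
rewrite ndist_zero; apply: Rmult_le_compat_l => //; apply: he.
by split; [apply: pow_le; lra | rewrite -(pow1 q.+1); apply: pow_incr; lra].
Qed.

End Conv.

Variables (a T : R).
Hypotheses (aT : a < T) (Ta1 : T <= a + 1).

(** The mild equation with frozen forcing. Using [is_RInt] keeps existence and value of the integral
    together. *)
Definition forward_mild (Y : B1) (g : R -> B) (b : R -> B1) : Prop :=
  forall t, a <= t <= T ->
    is_RInt (fun s => S (t - s) (g s)) a t (minus (j (b t)) (S (t - a) (j Y))).

(** After s = t - r^(q+1) the time [t] enters the convolution only through the shift of [g] and the
    upper limit. *)
Definition duhamel (Y : B1) (g : Contin a T B) (t : R) : B1 :=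
  plus (S1 (Rmax 0 (t - a)) Y)
    (conv (fun s => g (clamp a T (t - s))) (root q (clamp a T t - a))).

Let aT' : a <= T := Rlt_le _ _ aT.

Lemma clamp_shift_continuous (g : Contin a T B) t s :
  continuous (fun s => g (clamp a T (t - s))) s.
Proof.
apply: (continuous_comp (fun s => t - s) (fun s => g (clamp a T s))).
  exact: continuous_minus (continuous_const _ _) (continuous_id _).
exact: clamp_continuous.
Qed.

Lemma root_clamp_bounds t : 0 <= root q (clamp a T t - a) <= root q (T - a).
Proof.
have := clamp_in aT' t; split; first exact: root_ge0.
by apply: root_le_root; lra.
Qed.

Lemma root_le1 : root q (T - a) <= 1.
Proof. by apply: root_le; rewrite ?pow1; lra. Qed.

Lemma duhamel_continuous Y g t : continuous (duhamel Y g) t.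
Proof.
apply: continuous_plus.
  apply: (sg_comp_continuous S1_sg M1_ge0 m1_ge0 S1_bound (h := fun t => t - a)).
    exact: continuous_minus (continuous_id _) (continuous_const _ _).
  exact: continuous_const.
have [e he] := Contin_bounded aT' g (MkContin (@const_cont a T B zero)).
have {}he s : norm (g (clamp a T s)) <= e.
  by rewrite -ndist_zero; apply: he; apply: clamp_in.
have e0 : 0 <= e := Rle_trans _ _ _ (norm_ge_0 _) (he 0).
have r1 s : 0 <= root q (clamp a T s - a) <= 1.
  by have := root_clamp_bounds s; have := root_le1; lra.
apply/continuous_epsP => eps eps0; cbv beta.
pose d := eps / 4 / (C * (e + 1) + 1).
have Ce : 0 <= C * e by apply: Rmult_le_pos.
have c0 : 0 < C * (e + 1) + 1 by nra.
have d0 : 0 < d by apply: Rdiv_lt_0_compat c0; lra.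
have d4 : eps = 4 * ((C * (e + 1) + 1) * d) by rewrite /d; field; lra.
have cont s (hs : a - 1 <= s <= T) : continuous (fun s => g (clamp a T s)) s
  by exact: clamp_continuous.
have [[d1 d10] hd1] := unifcont_normed_1d _ _ _ cont (mkposreal _ d0).
have d20 : 0 < d ^ q.+1 by exact: pow_lt.
exists (Rmin d1 (d ^ q.+1)); split=> [|s hs]; first exact: Rmin_pos.
have hs1 := Rlt_le_trans _ _ _ hs (Rmin_l _ _).
have hs2 := Rlt_le_trans _ _ _ hs (Rmin_r _ _).
(* The clamped curve is constant beyond [a,T], so uniform continuity on a compact interval extends
   to the whole line. *)
have clampE x : g (clamp a T x) = g (clamp a T (clamp (a - 1) T x)).
  congr (g _); rewrite /clamp /Rmax /Rmin; do !case: Rle_dec; lra.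
have aT1 : a - 1 <= T by lra.
have ug x y : Rabs (x - y) < d1 -> ndist (g (clamp a T x)) (g (clamp a T y)) <= d.
  move=> xy; rewrite (clampE x) (clampE y); apply: Rlt_le.
  apply: (hd1 (clamp (a - 1) T y) (clamp (a - 1) T x)); try exact: clamp_in.
  exact: Rle_lt_trans (clamp_lip aT1 _ _) xy.
set rs := root q (clamp a T s - a); set rt := root q (clamp a T t - a).
set ks := fun s' => g (clamp a T (s - s')); set kt := fun s' => g (clamp a T (t - s')).
(* The two effects of moving the time are separated: first the integrand changes, then the upper
   limit. They cost at most C * d and C * e * d, together below eps / 4 by the choice of [d]. *)
apply: Rle_lt_trans (ndist_triangle _ (conv kt rs) _) _.
have e1 : ndist (conv ks rs) (conv kt rs) <= C * d * rs.
  apply: ndist_conv; try by move=> ?; exact: clamp_shift_continuous.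
    exact: r1.
  by move=> x _; apply: ug; have -> : s - x - (t - x) = s - t by ring.
have e2 : ndist (conv kt rs) (conv kt rt) <= C * e * Rabs (rs - rt).
  apply: ndist_conv_bound; try exact: r1.
    by move=> ?; exact: clamp_shift_continuous.
  by move=> x _; apply: he.
have e3 : Rabs (rs - rt) < d.
  apply: root_diff_lt => //; try by have := clamp_in aT' s; have := clamp_in aT' t; lra.
  apply: Rle_lt_trans hs2.
  have -> : clamp a T s - a - (clamp a T t - a) = clamp a T s - clamp a T t by ring.
  exact: clamp_lip.
have h1 : C * d * rs <= C * d * 1.
  by apply: Rmult_le_compat_l; [apply: Rmult_le_pos; lra | case: (r1 s)].
have h2 := Rmult_le_compat_l _ _ _ Ce (Rlt_le _ _ e3).
have : 0 <= C * e * d by apply: Rmult_le_pos; lra.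
have : 0 <= C * d by apply: Rmult_le_pos; lra.
rewrite d4; lra.
Qed.

Definition duhamel_curve Y g : Contin a T B1 :=
  MkContin (continuous_on_all (P := fun t => a <= t <= T) (@duhamel_continuous Y g)).

Lemma conv_shift (g : Contin a T B) t : a <= t <= T ->
  is_RInt (fun s => S (t - s) (g s)) a t
    (j (conv (fun s => g (clamp a T (t - s))) (root q (t - a)))).
Proof.
move=> ht.
have := is_RInt_conv (k := fun s => g (clamp a T (t - s)))
  (@clamp_shift_continuous g t) (root_ge0 q (t - a)).
rewrite root_pow; last lra.
have e0 : 0 = t - t by ring.
rewrite [X in is_RInt _ X]e0 => /is_RInt_reflect.
apply: is_RInt_ext => s; rewrite Rmin_left; last lra.
rewrite (Rmax_right a t) => [hs|]; last lra.
 rewrite Rmax_right; last lra.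
have -> : t - (t - s) = s by ring.
by rewrite clamp_id //; lra.
Qed.

Lemma duhamel_mild Y (g : Contin a T B) : forward_mild Y g (duhamel_curve Y g).
Proof.
move=> t ht; have := @conv_shift g t ht; rewrite /= /duhamel clamp_id //; try lra.
rewrite (linear_plus _ (incl_linear j)) Rmax_right; last lra.
rewrite S_restrict; last lra.
by rewrite /minus plus_comm plus_assoc plus_opp_l plus_zero_l.
Qed.

(** With the forcing frozen, the equation determines [j (b t)], and [j] is injective. *)
Lemma forward_mild_unique Y (g : Contin a T B) b : forward_mild Y g b ->
  forall t, a <= t <= T -> b t = duhamel_curve Y g t.
Proof.
move=> hb t ht; apply: (incl_inj (d := j)).
have e := eq_trans (esym (is_RInt_unique _ _ _ _ (hb t ht)))
  (is_RInt_unique _ _ _ _ (@duhamel_mild Y g t ht)).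
have := f_equal (plus^~ (S (t - a) (j Y))) e.
by rewrite /minus -!plus_assoc !plus_opp_l !plus_zero_r.
Qed.

(** The forcings are compared in [B], the solutions in [B1]: the gain that compensates the loss in
    [D]. [T <= a + 1] replaces the growth of [S1] by [exp m1]. *)
Lemma ndist_forward_mild Y Y' (g g' : Contin a T B) b b' :
  forward_mild Y g b -> forward_mild Y' g' b' -> forall t, a <= t <= T ->
  ndist (b t) (b' t) <=
    M1 * exp m1 * ndist Y Y' + C * root q (T - a) * Cdist g g'.
Proof.
move=> hb hb' t ht.
rewrite (forward_mild_unique hb) // (forward_mild_unique hb') // /= /duhamel.
apply: Rle_trans (ndist_plus _ _ _ _) _; apply: Rplus_le_compat.
  have t0 : 0 <= Rmax 0 (t - a) <= 1 by rewrite /Rmax; case: Rle_dec; lra.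
  rewrite (ndist_linear (sg_linear S1_sg t0.1)) -(Rmult_1_r m1).
  exact: sg_norm_le.
have [r0 r1] := root_clamp_bounds t; have r2 := root_le1.
have d0 := Cdist_ge0 aT' g g'.
apply: Rle_trans (ndist_conv (e := Cdist g g') _ _ _ _) _.
- by move=> s; exact: clamp_shift_continuous.
- by move=> s; exact: clamp_shift_continuous.
- by split; lra.
- by move=> s _; apply: le_Cdist => //; exact: clamp_in.
have -> : C * root q (T - a) * Cdist g g' = C * Cdist g g' * root q (T - a) by ring.
by apply: Rmult_le_compat_l => //; apply: Rmult_le_pos.
Qed.

Definition backward_mild (Z : B1) (g : R -> B) (f : R -> B1) : Prop :=
  forall t, a <= t <= T ->
    is_RInt (fun s => S (s - t) (g s)) t T (minus (S (T - t) (j Z)) (j (f t))).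

Lemma reverse_curve_continuous (V : UniformSpace) (g : Contin a T V) t :
  continuous (fun t => g (clamp a T (a + T - t))) t.
Proof.
apply: (continuous_comp (fun s => a + T - s) (fun s => g (clamp a T s))).
  exact: continuous_minus (continuous_const _ _) (continuous_id _).
exact: clamp_continuous.
Qed.

Definition reverse_curve (V : UniformSpace) (g : Contin a T V) : Contin a T V :=
  MkContin (continuous_on_all (P := fun t => a <= t <= T) (@reverse_curve_continuous V g)).

Lemma reverse_curveE (V : UniformSpace) (g : Contin a T V) t :
  a <= t <= T -> reverse_curve g t = g (a + T - t).
Proof. by move=> ht; rewrite /= clamp_id //; lra. Qed.

Lemma opp_curve_continuous (g : Contin a T B) t :
  continuous (fun t => opp (g (clamp a T t))) t.
Proof. by apply: continuous_opp; exact: clamp_continuous. Qed.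

(** Absorbs the minus sign before the backward integral once time is reversed. *)
Definition opp_curve (g : Contin a T B) : Contin a T B :=
  MkContin (continuous_on_all (P := fun t => a <= t <= T) (@opp_curve_continuous g)).

Lemma opp_curveE g t : a <= t <= T -> opp_curve g t = opp (g t).
Proof. by move=> ht; rewrite /= clamp_id. Qed.

(* Time reversal t -> a + T - t exchanges the two Duhamel formulas. *)
Lemma backward_mild_reverse Z (g : Contin a T B) (f : R -> B1) :
  backward_mild Z g f <->
  forward_mild Z (opp_curve (reverse_curve g)) (fun t => f (a + T - t)).
Proof.
have S_opp t x : 0 <= t -> S t (opp x) = opp (S t x).
  by move=> t0; rewrite (linear_opp _ _ (sg_linear S_sg t0)).
split=> h t ht; have ht' : a <= a + T - t <= T by lra.
  have {h} := h _ ht'.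
  have eT : T = a + T - a by ring.
  rewrite [X in is_RInt _ _ X]eT => /is_RInt_reflect/is_RInt_opp.
  rewrite opp_minus (_ : T - (a + T - t) = t - a); last ring.
  apply: is_RInt_ext => s; rewrite Rmin_left ?Rmax_right; try lra; move=> hs.
  rewrite opp_curveE ?reverse_curveE ?S_opp; try lra.
  by congr (opp (S _ _)); ring.
have {h} := h _ ht'; cbv beta.
have ea : a = a + T - T by ring.
rewrite [X in is_RInt _ X]ea => /is_RInt_reflect/is_RInt_opp.
rewrite opp_minus (_ : a + T - (a + T - t) = t); last ring.
rewrite (_ : a + T - t - a = T - t); last ring.
apply: is_RInt_ext => s; rewrite Rmin_left ?Rmax_right; try lra; move=> hs.
rewrite opp_curveE ?reverse_curveE ?S_opp ?opp_opp; try lra.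
by congr (S _ (g _)); ring.
Qed.

Definition duhamel_back Z g : Contin a T B1 :=
  reverse_curve (duhamel_curve Z (opp_curve (reverse_curve g))).

Lemma duhamel_back_mild Z (g : Contin a T B) : backward_mild Z g (duhamel_back Z g).
Proof.
apply/backward_mild_reverse => t ht; have := @duhamel_mild Z (opp_curve (reverse_curve g)) t ht.
rewrite /duhamel_back reverse_curveE; last lra.
by rewrite (_ : a + T - (a + T - t) = t); last ring.
Qed.

Lemma ndist_backward_mild Z Z' (g g' : Contin a T B) f f' :
  backward_mild Z g f -> backward_mild Z' g' f' -> forall t, a <= t <= T ->
  ndist (f t) (f' t) <=
    M1 * exp m1 * ndist Z Z' + C * root q (T - a) * Cdist g g'.
Proof.
move=> /backward_mild_reverse hf /backward_mild_reverse hf' t ht.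
have ht' : a <= a + T - t <= T by lra.
have := ndist_forward_mild hf hf' ht'; cbv beta.
rewrite (_ : a + T - (a + T - t) = t); last ring.
move=> h; apply: Rle_trans h _; apply: Rplus_le_compat_l; apply: Rmult_le_compat_l.
  by apply: Rmult_le_pos => //; apply: root_ge0.
apply: Cdist_le => // s hs; rewrite !opp_curveE // !reverse_curveE // ndist_opp.
by apply: le_Cdist => //; lra.
Qed.

End Duhamel.

(** * Contractive coupled systems *)

(** Replaces the passage to the limit in an inequality with geometrically small error. *)
Lemma le0_of_geom (x c : R) : (forall k, x <= c * (/ 2) ^ k) -> x <= 0.
Proof.
move=> h; apply: Rnot_lt_le => x0.
have c0 : 0 < c by have := h 0%nat; rewrite /=; lra.
have h2 : Rabs (/ 2) < 1 by rewrite Rabs_right; lra.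
have xc : 0 < x / c by exact: Rdiv_lt_0_compat.
have [N /(_ N (le_n _))] := pow_lt_1_zero (/ 2) h2 _ xc.
move=> /(Rle_lt_trans _ _ _ (Rle_abs _)) hN.
have := h N; have := Rmult_lt_compat_l _ _ _ c0 hN.
have -> : c * (x / c) = x by field; lra.
lra.
Qed.

(** A telescoping sum; the subtracted power makes the induction close. *)
Lemma Contin_geom_tail (a T : R) (aT : a <= T) (V : NormedModule R_AbsRing)
    (x : nat -> Contin a T V) c : (forall k, Cdist (x k) (x k.+1) <= c * (/ 2) ^ k) ->
  forall k i t, a <= t <= T ->
  ndist (x k t) (x (k + i)%nat t) <= 2 * c * ((/ 2) ^ k - (/ 2) ^ (k + i)).
Proof.
move=> hx k i t ht; elim: i => [|i IH]; first by rewrite addn0 ndist_self; lra.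
apply: Rle_trans (ndist_triangle _ (x (k + i)%nat t) _) _.
have := Rle_trans _ _ _ (le_Cdist aT (x (k + i)%nat) (x (k + i).+1) ht) (hx (k + i)%nat).
by rewrite addnS -[(/ 2) ^ (k + i).+1]tech_pow_Rmult; move: IH => /=; lra.
Qed.

Section ContinComplete.
Variables (a T : R) (aT : a <= T) (V : Banach).

(** Completeness of [V] gives pointwise limits. The rate, uniform in time, makes the limit
    continuous and is kept for later use. *)
Lemma Contin_complete (x : nat -> Contin a T V) c :
  (forall k, Cdist (x k) (x k.+1) <= c * (/ 2) ^ k) ->
  exists l : Contin a T V, forall k, Cdist (x k) l <= 2 * c * (/ 2) ^ k.
Proof.
move=> hx.
have c0 : 0 <= c by have := hx 0%nat; have := Cdist_ge0 aT (x 0%nat) (x 1%nat); rewrite /=; lra.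
have small eps : 0 < eps -> exists k, 2 * c * (/ 2) ^ k < eps.
  move=> eps0; apply: Classical_Prop.NNPP => hn.
  suff : eps <= 0 by lra.
  apply: (le0_of_geom (c := 2 * c)) => k; apply: Rnot_lt_le => hk; apply: hn; by exists k.
have tail k i t : a <= t <= T -> (k <= i)%nat -> ndist (x k t) (x i t) <= 2 * c * (/ 2) ^ k.
  move=> ht /subnKC <-; apply: Rle_trans (Contin_geom_tail aT hx _ _ ht) _.
  apply: Rmult_le_compat_l; first lra.
  have := pow_lt (/ 2) (k + (i - k)) ltac:(lra); lra.
pose y k t : V := x k (clamp a T t).
pose F t := filtermap (fun k => y k t) eventually.
have Fcauchy t : cauchy (F t).
  move=> eps; have [N hN] := small _ (cond_pos eps).
  exists (y N t); exists N => k /leP Nk; apply: norm_compat1.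
  apply: Rle_lt_trans hN; rewrite -/(ndist _ _) ndist_sym.
  by apply: tail => //; exact: clamp_in.
pose l t := lim (F t).
have lP t : filterlim (fun k => y k t) eventually (locally (l t)).
  by apply/filterlim_locally => eps; apply: (complete_cauchy (F t)).
have ldist k t : ndist (y k t) (l t) <= 2 * c * (/ 2) ^ k.
  apply: le_epsilon => eps eps0.
  have [N hN] := proj1 (filterlim_locally_ball_norm _ _) (lP t) (mkposreal _ eps0).
  apply: Rle_trans (ndist_triangle _ (y (maxn k N) t) _) _.
  apply: Rplus_le_compat; first by apply: tail; [exact: clamp_in | exact: leq_maxl].
  by apply: Rlt_le; apply: hN; apply/leP; exact: leq_maxr.
have lcont t : continuous l t.
  apply/continuous_epsP => eps eps0.
  have e30 : 0 < eps / 3 by lra.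
  have [k hk] := small _ e30.
  have yk_cont : continuous (y k) t by exact: clamp_continuous.
  have [d [d0 hd]] := proj1 (continuous_epsP _ _) yk_cont _ e30.
  exists d; split=> // s /hd hs.
  have h1 := ldist k s; have h2 := ldist k t; rewrite ndist_sym in h1.
  have h3 := ndist_triangle (l s) (y k s) (l t).
  have h4 := ndist_triangle (y k s) (y k t) (l t); lra.
exists (MkContin (continuous_on_all (P := fun t => a <= t <= T) lcont)) => k.
apply: Cdist_le => // t ht; rewrite -{1}(clamp_id aT ht); exact: ldist.
Qed.

Definition zero_curve (U : NormedModule R_AbsRing) : Contin a T U :=
  MkContin (@const_cont a T U zero).

End ContinComplete.

Section Coupled.
Variables (a T : R) (aT : a <= T) (B1 B B1b Bb : Banach).
Local Notation X := (Contin a T B1).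
Local Notation Xb := (Contin a T B1b).
Local Notation G := (Contin a T B).
Local Notation Gb := (Contin a T Bb).
Local Notation size f := (Cdist f (zero_curve a T _)).

Variables (mild : B1 -> G -> X -> Prop) (mildb : B1b -> Gb -> Xb -> Prop).
Variables (sol : B1 -> G -> X) (solb : B1b -> Gb -> Xb) (K eps : R).
Hypotheses (K_ge0 : 0 <= K) (eps_ge0 : 0 <= eps).
Hypothesis sol_mild : forall Y g, mild Y g (sol Y g).
Hypothesis solb_mild : forall Z g, mildb Z g (solb Z g).
Hypothesis mild_ext : forall Y g b b', Cdist b b' <= 0 -> mild Y g b -> mild Y g b'.
Hypothesis mildb_ext : forall Z g f f', Cdist f f' <= 0 -> mildb Z g f -> mildb Z g f'.
Hypothesis mild_dist : forall Y Y' g g' b b', mild Y g b -> mild Y' g' b' ->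
  Cdist b b' <= K * ndist Y Y' + eps * Cdist g g'.
Hypothesis mildb_dist : forall Z Z' g g' f f', mildb Z g f -> mildb Z' g' f' ->
  Cdist f f' <= K * ndist Z Z' + eps * Cdist g g'.
Hypothesis mild_zero : mild zero (zero_curve a T B) (zero_curve a T B1).
Hypothesis mildb_zero : mildb zero (zero_curve a T Bb) (zero_curve a T B1b).

Variables (F : X -> Xb -> G) (Fb : X -> Xb -> Gb) (lam : R) (Lam : R -> R).
Hypothesis F_growth : forall b f, size (F b f) <= lam * size b.
Hypothesis Fb_growth : forall b f, size (Fb b f) <= lam * size f.
Hypothesis F_lip : forall r b b' f f',
  size b <= r -> size b' <= r -> size f <= r -> size f' <= r ->
  Cdist (F b f) (F b' f') <= Lam r * (Cdist b b' + Cdist f f').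
Hypothesis Fb_lip : forall r b b' f f',
  size b <= r -> size b' <= r -> size f <= r -> size f' <= r ->
  Cdist (Fb b f) (Fb b' f') <= Lam r * (Cdist b b' + Cdist f f').
Hypothesis eps_lam : eps * lam <= / 2.

Definition coupled Y Z b f := mild Y (F b f) b /\ mildb Z (Fb b f) f.

(** Comparison with the zero solution. [b'] is kept apart from [b] because the bound serves Picard
    iterates as well as solutions. *)
Lemma mild_size Y b b' f : mild Y (F b f) b' -> size b' <= K * norm Y + / 2 * size b.
Proof.
move=> h; apply: Rle_trans (mild_dist h mild_zero) _; rewrite ndist_zero.
apply: Rplus_le_compat_l.
apply: Rle_trans (Rmult_le_compat_l _ _ _ eps_ge0 (F_growth b f)) _.
by rewrite -Rmult_assoc; apply: Rmult_le_compat_r => //; exact: Cdist_ge0.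
Qed.

Lemma mildb_size Z b f f' : mildb Z (Fb b f) f' -> size f' <= K * norm Z + / 2 * size f.
Proof.
move=> h; apply: Rle_trans (mildb_dist h mildb_zero) _; rewrite ndist_zero.
apply: Rplus_le_compat_l.
apply: Rle_trans (Rmult_le_compat_l _ _ _ eps_ge0 (Fb_growth b f)) _.
by rewrite -Rmult_assoc; apply: Rmult_le_compat_r => //; exact: Cdist_ge0.
Qed.

(** At a fixed point the half is absorbed on the left, whence the factor 2 in the radius. *)
Lemma coupled_size Y Z b f : coupled Y Z b f ->
  size b <= 2 * K * (norm Y + norm Z) /\ size f <= 2 * K * (norm Y + norm Z).
Proof.
move=> [/mild_size hb /mildb_size hf].
have := Rmult_le_pos _ _ K_ge0 (norm_ge_0 Y).
by have := Rmult_le_pos _ _ K_ge0 (norm_ge_0 Z); split; lra.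
Qed.

Section Ball.
Variable r : R.
Hypothesis eps_Lam : eps * Lam r <= / 4.

(** Each equation contributes at most 1/4 of the joint distance; hence the contraction factor 1/2
    for the sum. *)
Lemma coupled_step Y Y' Z Z' b b' f f' b1 b1' f1 f1' :
  size b <= r -> size b' <= r -> size f <= r -> size f' <= r ->
  mild Y (F b f) b1 -> mild Y' (F b' f') b1' ->
  mildb Z (Fb b f) f1 -> mildb Z' (Fb b' f') f1' ->
  Cdist b1 b1' + Cdist f1 f1' <=
    K * (ndist Y Y' + ndist Z Z') + / 2 * (Cdist b b' + Cdist f f').
Proof.
move=> br br' fr fr' h1 h2 h3 h4.
have e1 := mild_dist h1 h2; have e2 := mildb_dist h3 h4.
have e3 := Rmult_le_compat_l _ _ _ eps_ge0 (F_lip br br' fr fr').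
have e4 := Rmult_le_compat_l _ _ _ eps_ge0 (Fb_lip br br' fr fr').
have d0 : 0 <= Cdist b b' + Cdist f f'.
  by have := Cdist_ge0 aT b b'; have := Cdist_ge0 aT f f'; lra.
rewrite -Rmult_assoc in e3; rewrite -Rmult_assoc in e4.
by have := Rmult_le_compat_r _ _ _ d0 eps_Lam; lra.
Qed.

Lemma coupled_dist Y Y' Z Z' b b' f f' :
  2 * K * (norm Y + norm Z) <= r -> 2 * K * (norm Y' + norm Z') <= r ->
  coupled Y Z b f -> coupled Y' Z' b' f' ->
  Cdist b b' + Cdist f f' <= 2 * K * (ndist Y Y' + ndist Z Z').
Proof.
move=> hr hr' h h'; have [s1 s2] := coupled_size h; have [s3 s4] := coupled_size h'.
have := coupled_step (Rle_trans _ _ _ s1 hr) (Rle_trans _ _ _ s3 hr')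
  (Rle_trans _ _ _ s2 hr) (Rle_trans _ _ _ s4 hr') h.1 h'.1 h.2 h'.2; lra.
Qed.

Lemma coupled_exists Y Z : 2 * K * (norm Y + norm Z) <= r ->
  exists b f, coupled Y Z b f.
Proof.
move=> hr.
have KY := Rmult_le_pos _ _ K_ge0 (norm_ge_0 Y).
have KZ := Rmult_le_pos _ _ K_ge0 (norm_ge_0 Z).
(* Picard iterates from the zero pair. *)
pose x := fix x k := if k is k'.+1 then
  (sol Y (F (x k').1 (x k').2), solb Z (Fb (x k').1 (x k').2))
  else (zero_curve a T B1, zero_curve a T B1b).
have size0 (U : Banach) : size (zero_curve a T U) <= 0.
  by apply: Cdist_le => // t _; rewrite ndist_self; exact: Rle_refl.
have xr k : size (x k).1 <= r /\ size (x k).2 <= r.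
  elim: k => [|k [IH1 IH2]].
    by have := size0 B1; have := size0 B1b; rewrite /=; split; lra.
  have := mild_size (sol_mild Y (F (x k).1 (x k).2)).
  have := mildb_size (solb_mild Z (Fb (x k).1 (x k).2)).
  by rewrite /=; split; lra.
pose c := Cdist (x 0%nat).1 (x 1%nat).1 + Cdist (x 0%nat).2 (x 1%nat).2.
have hx k : Cdist (x k).1 (x k.+1).1 + Cdist (x k).2 (x k.+1).2 <= c * (/ 2) ^ k.
  elim: k => [|k IH]; first by rewrite /c /=; lra.
  have h : Cdist (x k.+1).1 (x k.+2).1 + Cdist (x k.+1).2 (x k.+2).2 <=
    K * (ndist Y Y + ndist Z Z) + / 2 * (Cdist (x k).1 (x k.+1).1 + Cdist (x k).2 (x k.+1).2).
    by apply: (coupled_step (xr k).1 (xr k.+1).1 (xr k).2 (xr k.+1).2).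
  by rewrite !ndist_self in h; rewrite -tech_pow_Rmult; lra.
have [|b hb] := @Contin_complete a T aT B1 (fun k => (x k).1) c.
  by move=> k; have := hx k; have := Cdist_ge0 aT (x k).2 (x k.+1).2; lra.
have [|f hf] := @Contin_complete a T aT B1b (fun k => (x k).2) c.
  by move=> k; have := hx k; have := Cdist_ge0 aT (x k).1 (x k.+1).1; lra.
have {}hb k : Cdist (x k).1 b <= 2 * c * (/ 2) ^ k by exact: hb.
have {}hf k : Cdist (x k).2 f <= 2 * c * (/ 2) ^ k by exact: hf.
(* The limit must lie in the ball too, for the Lipschitz bounds to apply to it. *)
have br : size b <= r.
  suff : size b - r <= 0 by lra.
  apply: (le0_of_geom (c := 2 * c)) => k.
  have := Cdist_triangle aT b (x k).1 (zero_curve a T B1).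
  by rewrite (Cdist_sym aT b (x k).1); have := hb k; have := (xr k).1; lra.
have fr : size f <= r.
  suff : size f - r <= 0 by lra.
  apply: (le0_of_geom (c := 2 * c)) => k.
  have := Cdist_triangle aT f (x k).2 (zero_curve a T B1b).
  by rewrite (Cdist_sym aT f (x k).2); have := hf k; have := (xr k).2; lra.
pose b' := sol Y (F b f); pose f' := solb Z (Fb b f).
(* Through the iterate [k.+1]: contraction gives 2 * c * (/ 2) ^ k for the first leg, and
   convergence the same for the second, whence 4 * c. *)
have bf' : Cdist b' b + Cdist f' f <= 0.
  apply: (le0_of_geom (c := 4 * c)) => k.
  have h : Cdist b' (x k.+1).1 + Cdist f' (x k.+1).2 <=
    K * (ndist Y Y + ndist Z Z) + / 2 * (Cdist b (x k).1 + Cdist f (x k).2).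
    by apply: (coupled_step br (xr k).1 fr (xr k).2).
  rewrite !ndist_self (Cdist_sym aT b) (Cdist_sym aT f) in h.
  have := Cdist_triangle aT b' (x k.+1).1 b; have := Cdist_triangle aT f' (x k.+1).2 f.
  have := hb k; have := hf k; have := hb k.+1; have := hf k.+1.
  by rewrite -!tech_pow_Rmult; lra.
(* [b'] solves the equation but agrees with [b] on [a,T] only; [mild_ext] tolerates the junk
   outside. *)
exists b, f; split.
  by apply: mild_ext (sol_mild Y (F b f)); have := Cdist_ge0 aT f' f; rewrite -/b'; lra.
by apply: mildb_ext (solb_mild Z (Fb b f)); have := Cdist_ge0 aT b' b; rewrite -/f'; lra.
Qed.

End Ball.
End Coupled.

(** * The forward-backward system *)

Section MildEquations.
Variables (B1 B : Banach) (j : dense_inclusion B1 B) (S : R -> B -> B).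
Hypothesis S_sg : C0_semigroup S.
Variables (a T : R).

Lemma forward_mild_ext Y (g g' : R -> B) (b b' : R -> B1) :
  (forall t, a <= t <= T -> g t = g' t) -> (forall t, a <= t <= T -> b t = b' t) ->
  forward_mild j S a T Y g b -> forward_mild j S a T Y g' b'.
Proof.
move=> gg' bb' h t ht; rewrite -bb' //; apply: is_RInt_ext (h t ht) => s.
by rewrite Rmin_left ?Rmax_right; try lra; move=> hs; rewrite gg' //; lra.
Qed.

Lemma backward_mild_ext Z (g g' : R -> B) (f f' : R -> B1) :
  (forall t, a <= t <= T -> g t = g' t) -> (forall t, a <= t <= T -> f t = f' t) ->
  backward_mild j S a T Z g f -> backward_mild j S a T Z g' f'.
Proof.
move=> gg' ff' h t ht; rewrite -ff' //; apply: is_RInt_ext (h t ht) => s.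
by rewrite Rmin_left ?Rmax_right; try lra; move=> hs; rewrite gg' //; lra.
Qed.

Lemma forward_mild_RInt Y (g : R -> B) (b : R -> B1) : forward_mild j S a T Y g b <->
  forall t, a <= t <= T -> ex_RInt (fun s => S (t - s) (g s)) a t /\
    j (b t) = plus (S (t - a) (j Y)) (RInt (fun s => S (t - s) (g s)) a t).
Proof.
split=> h t /h => [ht|[ex e]].
  split; first by eexists; exact: ht.
  by rewrite (is_RInt_unique _ _ _ _ ht) /minus plus_comm -plus_assoc plus_opp_l plus_zero_r.
have := RInt_correct _ _ _ ex.
by rewrite e /minus plus_comm plus_assoc plus_opp_l plus_zero_l.
Qed.

Lemma backward_mild_RInt Z (g : R -> B) (f : R -> B1) : backward_mild j S a T Z g f <->
  forall t, a <= t <= T -> ex_RInt (fun s => S (s - t) (g s)) t T /\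
    j (f t) = minus (S (T - t) (j Z)) (RInt (fun s => S (s - t) (g s)) t T).
Proof.
split=> h t /h => [ht|[ex e]].
  split; first by eexists; exact: ht.
  by rewrite (is_RInt_unique _ _ _ _ ht) /minus opp_plus plus_assoc plus_opp_r plus_zero_l opp_opp.
have := RInt_correct _ _ _ ex.
by rewrite e /minus opp_plus plus_assoc plus_opp_r plus_zero_l opp_opp.
Qed.

Lemma is_RInt_zero (f : R -> B) x y :
  (forall s, Rmin x y < s < Rmax x y -> f s = zero) -> is_RInt f x y zero.
Proof.
move=> h; rewrite -(scal_zero_r (y - x)).
by apply: is_RInt_ext (is_RInt_const _ _ _) => s /h.
Qed.

Lemma forward_mild_zero : forward_mild j S a T zero (fun=> zero) (fun=> zero).
Proof.
move=> t ht; rewrite !(linear_zero _ (incl_linear j)) linear_zero ?minus_eq_zero.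
  apply: is_RInt_zero => s; rewrite Rmin_left ?Rmax_right; try lra; move=> hs.
  by rewrite linear_zero //; apply: (sg_linear S_sg); lra.
by apply: (sg_linear S_sg); lra.
Qed.

Lemma backward_mild_zero : backward_mild j S a T zero (fun=> zero) (fun=> zero).
Proof.
move=> t ht; rewrite !(linear_zero _ (incl_linear j)) linear_zero ?minus_eq_zero.
  apply: is_RInt_zero => s; rewrite Rmin_left ?Rmax_right; try lra; move=> hs.
  by rewrite linear_zero //; apply: (sg_linear S_sg); lra.
by apply: (sg_linear S_sg); lra.
Qed.

End MildEquations.

(** * Growth and Lipschitz estimates for the forcing terms *)

Section FiniteSums.
Variable n : nat.

(** The number n, shaped like [sum_norm] for a termwise comparison. *)
Definition Rcard : R := \big[Rplus/0]_(j < n) 1.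

Lemma Rcard_ge0 : 0 <= Rcard.
Proof. by rewrite /Rcard; apply: big_ind => [|x y|_ _]; lra. Qed.

Lemma sum_norm_ge0 (V : NormedModule R_AbsRing) (v : 'I_n -> V) : 0 <= sum_norm v.
Proof.
rewrite /sum_norm; apply: big_ind => [|x y|i _]; [lra | lra | exact: norm_ge_0].
Qed.

Lemma sum_norm_le (V : NormedModule R_AbsRing) (v : 'I_n -> V) c :
  (forall i, norm (v i) <= c) -> sum_norm v <= Rcard * c.
Proof.
move=> h; rewrite /sum_norm /Rcard.
apply: (big_ind2 (fun x y => x <= y * c)) => [|x1 x2 y1 y2|i _]; [lra | lra |].
by rewrite Rmult_1_l.
Qed.

End FiniteSums.

(** The constants of the hypotheses carry no sign, so monotonicity needs absolute values. *)
Lemma lip_factor_le L L' x y X Y : 0 <= x <= X -> 0 <= y <= Y ->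
  L * x * (1 + L' * y) <= Rabs L * X * (1 + Rabs L' * Y).
Proof.
move=> hx hy; apply: Rle_trans (Rle_abs _) _; rewrite !Rabs_mult (Rabs_right x); last lra.
have h : Rabs (1 + L' * y) <= 1 + Rabs L' * Y.
  apply: Rle_trans (Rabs_triang _ _) _; rewrite Rabs_R1 Rabs_mult (Rabs_right y); last lra.
  by apply/Rplus_le_compat_l/Rmult_le_compat_l; [exact: Rabs_pos | lra].
have L0 := Rabs_pos L.
apply: Rmult_le_compat => //; try exact: Rabs_pos.
  by apply: Rmult_le_pos; lra.
by apply: Rmult_le_compat_l; lra.
Qed.

Lemma continuous_pair (T U V : UniformSpace) (f : T -> U) (g : T -> V) t :
  continuous f t -> continuous g t -> continuous (fun s => (f s, g s)) t.
Proof.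
move=> /filterlim_locally hf /filterlim_locally hg; apply/filterlim_locally => eps.
exact: filter_and (hf eps) (hg eps).
Qed.

Section ContractiveFamily.
Variables (n : nat) (V W : Banach) (D : 'I_n -> V -> W).
Hypothesis D_lin : forall i, is_linear (D i) /\ op_norm (D i) <= 1.

Lemma contractive_norm i x : norm (D i x) <= norm x.
Proof.
have [lin h1] := D_lin i; apply: Rle_trans (op_norm_le lin x) _.
by rewrite -[X in _ <= X]Rmult_1_l; apply: Rmult_le_compat_r => //; exact: norm_ge_0.
Qed.

Lemma contractive_sum_norm x : sum_norm (fun i => D i x) <= Rcard n * norm x.
Proof. by apply: sum_norm_le => i; apply: contractive_norm. Qed.

Lemma contractive_ndist i x y : ndist (D i x) (D i y) <= ndist x y.
Proof. by have [lin _] := D_lin i; rewrite (ndist_linear lin); apply: contractive_norm. Qed.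

Lemma contractive_sum_diff x y :
  sum_norm (diff (fun i => D i x) (fun i => D i y)) <= Rcard n * ndist x y.
Proof. by apply: sum_norm_le => i; apply: contractive_ndist. Qed.

(** One ball around [b t] serves all indices, since every [D i] is a contraction. *)
Lemma contractive_continuous (b : R -> V) t : continuous b t ->
  continuous (fun s => (fun i => D i (b s)) : 'I_n -> W) t.
Proof.
move=> /filterlim_locally_ball_norm hb; apply/filterlim_locally => eps.
apply: filter_imp (hb eps) => s hs i; apply: norm_compat1.
by apply: Rle_lt_trans hs; apply: contractive_ndist.
Qed.

Lemma contractive_args_le (j : dense_inclusion V W) x y :
  0 <= ndist (j x) (j y) + sum_norm (diff (fun i => D i x) (fun i => D i y))
    <= (1 + Rcard n) * ndist x y.
Proof.
have := contractive_sum_diff x y; have := ndist_incl j x y.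
have := ndist_ge0 (j x) (j y).
have := sum_norm_ge0 (diff (fun i => D i x) (fun i => D i y)); lra.
Qed.

End ContractiveFamily.

Section Forcing.
Variables (a T : R) (aT : a <= T) (B1 B B1b Bb Bcon : Banach).
Variables (j : dense_inclusion B1 B) (jb : dense_inclusion B1b Bb).
Variables (n : nat) (D : 'I_n -> B1 -> B) (Db : 'I_n -> B1b -> Bb).
Hypothesis D_lin : forall i, is_linear (D i) /\ op_norm (D i) <= 1.
Hypothesis Db_lin : forall i, is_linear (Db i) /\ op_norm (Db i) <= 1.
Variables (H : R -> B -> ('I_n -> B) -> Bcon -> B).
Variables (Hb : R -> Bb -> ('I_n -> Bb) -> Contin a T B -> Bb).
Variables (u : R -> Bb -> ('I_n -> Bb) -> Bcon).
Hypothesis H_cont : jointly_continuous4 H.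
Hypothesis Hb_cont : jointly_continuous4 Hb.
Hypothesis u_cont : jointly_continuous3 u.

Let H_at (s : R) (x : B1) (y : B1b) : B :=
  H s (j x) (fun i => D i x) (u s (jb y) (fun i => Db i y)).

Let Hb_at (s : R) (y : B1b) (b : Contin a T B1) : Bb :=
  Hb s (jb y) (fun i => Db i y) (incl_curve j b).

Lemma forcing_continuous (b : Contin a T B1) (f : Contin a T B1b) t :
  continuous (fun s => H_at s (b (clamp a T s)) (f (clamp a T s))) t.
Proof.
have bc : continuous (fun s => b (clamp a T s)) t by exact: clamp_continuous.
have fc : continuous (fun s => f (clamp a T s)) t by exact: clamp_continuous.
have uc : continuous (fun s => u s (jb (f (clamp a T s))) (fun i => Db i (f (clamp a T s)))) t.
  apply: (continuous_comp (fun s => (s, jb (f (clamp a T s)), fun i => Db i (f (clamp a T s))))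
    (fun p : R * Bb * ('I_n -> Bb) => u p.1.1 p.1.2 p.2)); last exact: u_cont.
  apply: continuous_pair; last exact: contractive_continuous.
  apply: continuous_pair; first exact: continuous_id.
  by apply: continuous_comp fc _; apply: linear_cont; exact: incl_linear.
apply: (continuous_comp (fun s => (s, j (b (clamp a T s)), fun i => D i (b (clamp a T s)),
    u s (jb (f (clamp a T s))) (fun i => Db i (f (clamp a T s)))))
  (fun p : R * B * ('I_n -> B) * Bcon => H p.1.1.1 p.1.1.2 p.1.2 p.2)); last exact: H_cont.
apply: continuous_pair uc; apply: continuous_pair; last exact: contractive_continuous.
apply: continuous_pair; first exact: continuous_id.
by apply: continuous_comp bc _; apply: linear_cont; exact: incl_linear.
Qed.

Definition forcing b f : Contin a T B :=
  MkContin (continuous_on_all (P := fun t => a <= t <= T) (@forcing_continuous b f)).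

Lemma forcing_back_continuous (b : Contin a T B1) (f : Contin a T B1b) t :
  continuous (fun s => Hb_at s (f (clamp a T s)) b) t.
Proof.
have fc : continuous (fun s => f (clamp a T s)) t by exact: clamp_continuous.
apply: (continuous_comp (fun s => (s, jb (f (clamp a T s)), fun i => Db i (f (clamp a T s)),
    incl_curve j b))
  (fun p : R * Bb * ('I_n -> Bb) * Contin a T B => Hb p.1.1.1 p.1.1.2 p.1.2 p.2)); last exact: Hb_cont.
apply: continuous_pair; last exact: continuous_const.
apply: continuous_pair; last exact: contractive_continuous.
apply: continuous_pair; first exact: continuous_id.
by apply: continuous_comp fc _; apply: linear_cont; exact: incl_linear.
Qed.

Definition forcing_back b f : Contin a T Bb :=
  MkContin (continuous_on_all (P := fun t => a <= t <= T) (@forcing_back_continuous b f)).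

(** Rewrites the system as two linear problems whose forcings are produced by the solution itself,
    the form required by [coupled]. *)
Lemma mild_solutionP S Sb Y Z b f : mild_solution j jb D Db S Sb H Hb u Y Z b f <->
  forward_mild j S a T Y (forcing b f) b /\ backward_mild jb Sb a T Z (forcing_back b f) f.
Proof.
have e1 t : a <= t <= T -> forcing b f t = H_at t (b t) (f t).
  by move=> ht; rewrite /= clamp_id.
have e2 t : a <= t <= T -> forcing_back b f t = Hb_at t (f t) b.
  by move=> ht; rewrite /= clamp_id.
split=> [h|[hb hf] forward backward t ht].
  split.
    apply: (forward_mild_ext (fun t ht => esym (e1 t ht)) (fun t _ => erefl)).
    by apply/forward_mild_RInt => t /h [].
  apply: (backward_mild_ext (fun t ht => esym (e2 t ht)) (fun t _ => erefl)).
  by apply/backward_mild_RInt => t /h [].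
have /forward_mild_RInt/(_ t ht) [h1 h2] := forward_mild_ext e1 (fun t _ => erefl) hb.
by have /backward_mild_RInt/(_ t ht) [h3 h4] := backward_mild_ext e2 (fun t _ => erefl) hf; split.
Qed.

Variables LH LH' LHpar LHb LHb' Lu : R.
Hypothesis H_lip : forall (t : R) (b0 b0' : B) (b b' : 'I_n -> B) (v : Bcon),
  norm (minus (H t b0 b v) (H t b0' b' v))
  <= LH * (norm (minus b0 b0') + sum_norm (diff b b')) * (1 + LH' * sum_norm b).
Hypothesis H_lip_par : forall (t : R) (b0 : B) (b : 'I_n -> B) (v v' : Bcon),
  norm (minus (H t b0 b v) (H t b0 b v'))
  <= LHpar * norm (minus v v') * (1 + sum_norm b).
Hypothesis H_bound : forall (t : R) (b0 : B) (b : 'I_n -> B) (v : Bcon),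
  norm (H t b0 b v) <= LH * sum_norm b.
Hypothesis Hb_lip : forall (t : R) (f0 f0' : Bb) (f f' : 'I_n -> Bb) (b : Contin a T B),
  norm (minus (Hb t f0 f b) (Hb t f0' f' b))
  <= LHb * (norm (minus f0 f0') + sum_norm (diff f f')) * (1 + LHb' * sum_norm f).
Hypothesis Hb_lip_curve : forall (t : R) (f0 : Bb) (f : 'I_n -> Bb) (b b' : Contin a T B),
  norm (minus (Hb t f0 f b) (Hb t f0 f b'))
  <= LHb * Cdist b b' * (1 + (norm f0 + sum_norm f)).
Hypothesis Hb_bound : forall (t : R) (f0 : Bb) (f : 'I_n -> Bb) (b : Contin a T B),
  norm (Hb t f0 f b) <= LHb * sum_norm f.
Hypothesis u_lip : forall (t : R) (f0 f0' : Bb) (f f' : 'I_n -> Bb),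
  norm (minus (u t f0 f) (u t f0' f'))
  <= Lu * (norm (minus f0 f0') + sum_norm (diff f f')).

Local Notation N := (Rcard n).
Local Notation size f := (Cdist f (zero_curve a T _)).

Definition growth_const : R := (Rabs LH + Rabs LHb) * N.

(** Sums the constants of both equations, so that one number serves for both. The last summand puts
    it above [growth_const]: a single smallness condition then covers growth and contraction. *)
Definition lip_const (r : R) : R :=
  Rabs LH * (1 + N) * (1 + Rabs LH' * (N * r))
  + Rabs LHpar * (Rabs Lu * (1 + N)) * (1 + N * r)
  + Rabs LHb * (1 + N) * (1 + Rabs LHb' * (N * r))
  + Rabs LHb * (1 + (1 + N) * r) + growth_const.

Lemma H_at_growth s x y : norm (H_at s x y) <= Rabs LH * (N * norm x).
Proof.
apply: Rle_trans (H_bound _ _ _ _) _; apply: Rle_trans (Rle_abs _) _.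
rewrite Rabs_mult; apply: Rmult_le_compat_l; first exact: Rabs_pos.
rewrite Rabs_right; last by apply/Rle_ge; exact: sum_norm_ge0.
exact: contractive_sum_norm.
Qed.

Lemma Hb_at_growth s y b : norm (Hb_at s y b) <= Rabs LHb * (N * norm y).
Proof.
apply: Rle_trans (Hb_bound _ _ _ _) _; apply: Rle_trans (Rle_abs _) _.
rewrite Rabs_mult; apply: Rmult_le_compat_l; first exact: Rabs_pos.
rewrite Rabs_right; last by apply/Rle_ge; exact: sum_norm_ge0.
exact: contractive_sum_norm.
Qed.

Lemma size_at (V : Banach) (f : Contin a T V) t : norm (f (clamp a T t)) <= size f.
Proof.
rewrite -ndist_zero; exact: (le_Cdist aT f (zero_curve a T V) (clamp_in aT t)).
Qed.

Lemma forcing_growth b f : size (forcing b f) <= growth_const * size b.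
Proof.
apply: Cdist_le => // t _; rewrite ndist_zero.
apply: Rle_trans (H_at_growth _ _ _) _; rewrite /growth_const.
have h := Rmult_le_compat_l _ _ _ (Rcard_ge0 n) (size_at b t).
have := Rmult_le_compat_l _ _ _ (Rabs_pos LH) h.
have := Rmult_le_pos _ _ (Rabs_pos LHb) (Rmult_le_pos _ _ (Rcard_ge0 n) (Cdist_ge0 aT b (zero_curve a T _))).
lra.
Qed.

Lemma forcing_back_growth b f : size (forcing_back b f) <= growth_const * size f.
Proof.
apply: Cdist_le => // t _; rewrite ndist_zero.
apply: Rle_trans (Hb_at_growth _ _ _) _; rewrite /growth_const.
have h := Rmult_le_compat_l _ _ _ (Rcard_ge0 n) (size_at f t).
have := Rmult_le_compat_l _ _ _ (Rabs_pos LHb) h.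
have := Rmult_le_pos _ _ (Rabs_pos LH) (Rmult_le_pos _ _ (Rcard_ge0 n) (Cdist_ge0 aT f (zero_curve a T _))).
lra.
Qed.

Lemma H_at_lip r s x x' y y' : norm x <= r -> norm x' <= r ->
  ndist (H_at s x y) (H_at s x' y') <=
    Rabs LH * ((1 + N) * ndist x x') * (1 + Rabs LH' * (N * r))
    + Rabs LHpar * (Rabs Lu * ((1 + N) * ndist y y')) * (1 + N * r).
Proof.
move=> xr x'r; have N0 := Rcard_ge0 n.
have sr z : norm z <= r -> 0 <= sum_norm (fun i => D i z) <= N * r.
  move=> zr; split; first exact: sum_norm_ge0.
  apply: Rle_trans (contractive_sum_norm D_lin z) _; exact: Rmult_le_compat_l.
(* The state arguments move first, with the control kept at [y]; then the control moves alone. *)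
apply: Rle_trans (ndist_triangle _ (H s (j x') (fun i => D i x') (u s (jb y) (fun i => Db i y))) _) _.
apply: Rplus_le_compat.
  apply: Rle_trans (H_lip _ _ _ _ _ _) _.
  by apply: lip_factor_le; [exact: contractive_args_le | exact: sr].
apply: Rle_trans (H_lip_par _ _ _ _ _) _.
have := @lip_factor_le LHpar 1 _ _ (Rabs Lu * ((1 + N) * ndist y y')) (N * r) _ (sr x' x'r).
rewrite !Rabs_R1 !Rmult_1_l; apply; split; first exact: ndist_ge0.
apply: Rle_trans (u_lip _ _ _ _ _) _; apply: Rle_trans (Rle_abs _) _.
have h := contractive_args_le Db_lin jb y y'.
rewrite Rabs_mult; apply: Rmult_le_compat_l; first exact: Rabs_pos.
by rewrite Rabs_right; [exact: h.2 | exact/Rle_ge/h.1].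
Qed.

Lemma Hb_at_lip r s y y' b b' : norm y <= r -> norm y' <= r ->
  ndist (Hb_at s y b) (Hb_at s y' b') <=
    Rabs LHb * ((1 + N) * ndist y y') * (1 + Rabs LHb' * (N * r))
    + Rabs LHb * Cdist b b' * (1 + (1 + N) * r).
Proof.
move=> yr y'r; have N0 := Rcard_ge0 n.
have sr z : norm z <= r -> 0 <= sum_norm (fun i => Db i z) <= N * r.
  move=> zr; split; first exact: sum_norm_ge0.
  apply: Rle_trans (contractive_sum_norm Db_lin z) _; exact: Rmult_le_compat_l.
apply: Rle_trans (ndist_triangle _ (Hb s (jb y') (fun i => Db i y') (incl_curve j b)) _) _.
apply: Rplus_le_compat.
  apply: Rle_trans (Hb_lip _ _ _ _ _ _) _.
  by apply: lip_factor_le; [exact: contractive_args_le | exact: sr].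
apply: Rle_trans (Hb_lip_curve _ _ _ _ _) _.
have := @lip_factor_le LHb 1 (Cdist (incl_curve j b) (incl_curve j b'))
  (norm (jb y') + sum_norm (fun i => Db i y')) (Cdist b b') ((1 + N) * r).
rewrite !Rabs_R1 !Rmult_1_l; apply.
  split; first exact: Cdist_ge0.
  by apply: Cdist_le => // t ht; apply: Rle_trans (ndist_incl _ _ _) _; exact: le_Cdist.
have [h1 h2] := sr _ y'r; have := norm_ge_0 (jb y'); have := incl_norm jb y'; lra.
Qed.

Lemma lip_const_terms r : 0 <= r ->
  [/\ 0 <= Rabs LH * (1 + N) * (1 + Rabs LH' * (N * r)),
      0 <= Rabs LHpar * (Rabs Lu * (1 + N)) * (1 + N * r),
      0 <= Rabs LHb * (1 + N) * (1 + Rabs LHb' * (N * r)),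
      0 <= Rabs LHb * (1 + (1 + N) * r) & 0 <= growth_const].
Proof.
move=> r0; have N0 := Rcard_ge0 n.
have P L : 0 <= Rabs L := Rabs_pos L.
have Nr : 0 <= N * r by exact: Rmult_le_pos.
have PNr L : 0 <= 1 + Rabs L * (N * r).
  by have := Rmult_le_pos _ _ (P L) Nr; lra.
by split; rewrite /growth_const; repeat apply: Rmult_le_pos => //; have := P LH; have := P LHb; lra.
Qed.

Lemma growth_const_le r : 0 <= r -> growth_const <= lip_const r.
Proof. by case/lip_const_terms => *; rewrite /lip_const; lra. Qed.

Lemma lip_const_mono r r' : 0 <= r <= r' -> lip_const r <= lip_const r'.
Proof.
move=> [r0 rr']; have N0 := Rcard_ge0 n; rewrite /lip_const.
have P L : 0 <= Rabs L := Rabs_pos L.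
have Nr : N * r <= N * r' by exact: Rmult_le_compat_l.
repeat apply: Rplus_le_compat; try exact: Rle_refl; apply: Rmult_le_compat_l.
- by apply: Rmult_le_pos => //; lra.
- by apply/Rplus_le_compat_l/Rmult_le_compat_l.
- by repeat apply: Rmult_le_pos => //; lra.
- exact/Rplus_le_compat_l.
- by apply: Rmult_le_pos => //; lra.
- by apply/Rplus_le_compat_l/Rmult_le_compat_l.
- exact: P.
- by apply/Rplus_le_compat_l/Rmult_le_compat_l => //; lra.
Qed.

Lemma forcing_lip r b b' f f' :
  size b <= r -> size b' <= r -> size f <= r -> size f' <= r ->
  Cdist (forcing b f) (forcing b' f') <= lip_const r * (Cdist b b' + Cdist f f').
Proof.
move=> br br' fr fr'; have r0 : 0 <= r := Rle_trans _ _ _ (Cdist_ge0 aT _ _) br.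
apply: Cdist_le => // t _.
pose x : B1 := b (clamp a T t); pose x' : B1 := b' (clamp a T t).
pose y : B1b := f (clamp a T t); pose y' : B1b := f' (clamp a T t).
have xr : norm x <= r := Rle_trans _ _ _ (size_at b t) br.
have xr' : norm x' <= r := Rle_trans _ _ _ (size_at b' t) br'.
have db : ndist x x' <= Cdist b b' := le_Cdist aT b b' (clamp_in aT t).
have df : ndist y y' <= Cdist f f' := le_Cdist aT f f' (clamp_in aT t).
apply: Rle_trans (H_at_lip t y y' xr xr') _.
have db0 := Cdist_ge0 aT b b'; have df0 := Cdist_ge0 aT f f'.
have [t1 t2 t3 t4 t5] := lip_const_terms r0; rewrite /lip_const.
have := Rmult_le_compat_l _ _ _ t1 db; have := Rmult_le_compat_l _ _ _ t2 df.
have := Rmult_le_pos _ _ t1 df0; have := Rmult_le_pos _ _ t2 db0.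
have t345 : 0 <= Rabs LHb * (1 + N) * (1 + Rabs LHb' * (N * r))
  + Rabs LHb * (1 + (1 + N) * r) + growth_const by lra.
have := Rmult_le_pos _ _ t345 (Rplus_le_le_0_compat _ _ db0 df0).
lra.
Qed.

Lemma forcing_back_lip r b b' f f' :
  size b <= r -> size b' <= r -> size f <= r -> size f' <= r ->
  Cdist (forcing_back b f) (forcing_back b' f') <= lip_const r * (Cdist b b' + Cdist f f').
Proof.
move=> br br' fr fr'; have r0 : 0 <= r := Rle_trans _ _ _ (Cdist_ge0 aT _ _) br.
apply: Cdist_le => // t _.
pose y : B1b := f (clamp a T t); pose y' : B1b := f' (clamp a T t).
have yr : norm y <= r := Rle_trans _ _ _ (size_at f t) fr.
have yr' : norm y' <= r := Rle_trans _ _ _ (size_at f' t) fr'.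
have df : ndist y y' <= Cdist f f' := le_Cdist aT f f' (clamp_in aT t).
apply: Rle_trans (Hb_at_lip t b b' yr yr') _.
have db0 := Cdist_ge0 aT b b'; have df0 := Cdist_ge0 aT f f'.
have [t1 t2 t3 t4 t5] := lip_const_terms r0; rewrite /lip_const.
have := Rmult_le_compat_l _ _ _ t3 df.
have := Rmult_le_pos _ _ t3 db0; have := Rmult_le_pos _ _ t4 df0.
have t125 : 0 <= Rabs LH * (1 + N) * (1 + Rabs LH' * (N * r))
  + Rabs LHpar * (Rabs Lu * (1 + N)) * (1 + N * r) + growth_const by lra.
have := Rmult_le_pos _ _ t125 (Rplus_le_le_0_compat _ _ db0 df0).
lra.
Qed.

End Forcing.

(** * Choice of the time interval and assembly of the theorem *)

Lemma small_time (q : nat) C L x : 0 <= C -> 0 <= L -> 0 <= x ->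
  x < (/ (1 + 4 * C * L)) ^ q.+1 -> C * root q x * L <= / 4 /\ x <= 1.
Proof.
move=> C0 L0 x0 hx; have CL := Rmult_le_pos _ _ C0 L0.
(* The root of [x] is below [d], and C * L * d <= 1/4; the summand 1 gives [d <= 1], hence
   [x <= 1]. *)
set d := / (1 + 4 * C * L) in hx.
have d0 : 0 < d by apply: Rinv_0_lt_compat; lra.
have de : d * (1 + 4 * C * L) = 1 by rewrite /d Rinv_l; lra.
have d1 : d <= 1 by nra.
have hr := root_lt x0 (Rlt_le _ _ d0) hx; split.
  have := Rmult_le_compat_l _ _ _ CL (Rlt_le _ _ hr); lra.
apply: Rle_trans (Rlt_le _ _ hx) _; rewrite -(pow1 q.+1); apply: pow_incr; lra.
Qed.

Lemma pow_inv_anti (q : nat) x y : 0 < x <= y -> (/ y) ^ q <= (/ x) ^ q.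
Proof.
move=> [x0 xy]; apply: pow_incr; split.
  by apply/Rlt_le/Rinv_0_lt_compat; lra.
exact: Rinv_le_contravar.
Qed.

Theorem theorem6p1
  (a : R)
  (B2 B1 B B2b B1b Bb Bcon : Banach)
  (j2 : dense_inclusion B2 B1) (j1 : dense_inclusion B1 B)
  (j2b : dense_inclusion B2b B1b) (j1b : dense_inclusion B1b Bb)
  (n : nat) (D : 'I_n -> B1 -> B) (Db : 'I_n -> B1b -> Bb)
  (hD : forall i, contraction_pair j2 j1 (D i))
  (hDb : forall i, contraction_pair j2b j1b (Db i))
  (A : B2 -> B) (S : R -> B -> B) (S1 : R -> B1 -> B1)
  (hA : generates j2 j1 A S S1)
  (M m M1 m1 : R) (hM : 0 <= M) (hm : 0 <= m) (hM1 : 0 <= M1) (hm1 : 0 <= m1)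
  (hS : forall t, 0 <= t -> op_norm (S t) <= M * exp (m * t))
  (hS1 : forall t, 0 <= t -> op_norm (S1 t) <= M1 * exp (m1 * t))
  (Ab : B2b -> Bb) (Sb : R -> Bb -> Bb) (S1b : R -> B1b -> B1b)
  (hAb : generates j2b j1b Ab Sb S1b)
  (Mb mb M1b m1b : R) (hMb : 0 <= Mb) (hmb : 0 <= mb) (hM1b : 0 <= M1b) (hm1b : 0 <= m1b)
  (hSb : forall t, 0 <= t -> op_norm (Sb t) <= Mb * exp (mb * t))
  (hS1b : forall t, 0 <= t -> op_norm (S1b t) <= M1b * exp (m1b * t))
  (H : R -> B -> ('I_n -> B) -> Bcon -> B)
  (H_cont : jointly_continuous4 H)
  (LH LH' LHpar : R)
  (H_lip : forall (t : R) (b0 b0' : B) (b b' : 'I_n -> B) (v : Bcon),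
     norm (minus (H t b0 b v) (H t b0' b' v))
     <= LH * (norm (minus b0 b0') + sum_norm (diff b b')) * (1 + LH' * sum_norm b))
  (H_lip_par : forall (t : R) (b0 : B) (b : 'I_n -> B) (v v' : Bcon),
     norm (minus (H t b0 b v) (H t b0 b v'))
     <= LHpar * norm (minus v v') * (1 + sum_norm b))
  (H_bound : forall (t : R) (b0 : B) (b : 'I_n -> B) (v : Bcon),
     norm (H t b0 b v) <= LH * sum_norm b)
  (Hb : forall T : R, R -> Bb -> ('I_n -> Bb) -> Contin a T B -> Bb)
  (Hb_cont : forall T, a < T -> jointly_continuous4 (Hb T))
  (Hb_future : forall T, a < T ->
     forall (t : R) (f0 : Bb) (f : 'I_n -> Bb) (b b' : Contin a T B),
     (forall s, a <= s <= T -> t <= s -> b s = b' s) ->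
     Hb T t f0 f b = Hb T t f0 f b')
  (LHb LHb' : R)
  (Hb_lip : forall T, a < T ->
     forall (t : R) (f0 f0' : Bb) (f f' : 'I_n -> Bb) (b : Contin a T B),
     norm (minus (Hb T t f0 f b) (Hb T t f0' f' b))
     <= LHb * (norm (minus f0 f0') + sum_norm (diff f f')) * (1 + LHb' * sum_norm f))
  (Hb_lip_curve : forall T, a < T ->
     forall (t : R) (f0 : Bb) (f : 'I_n -> Bb) (b b' : Contin a T B),
     norm (minus (Hb T t f0 f b) (Hb T t f0 f b'))
     <= LHb * Cdist b b' * (1 + (norm f0 + sum_norm f)))
  (Hb_bound : forall T, a < T ->
     forall (t : R) (f0 : Bb) (f : 'I_n -> Bb) (b : Contin a T B),
     norm (Hb T t f0 f b) <= LHb * sum_norm f)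
  (u : R -> Bb -> ('I_n -> Bb) -> Bcon)
  (u_cont : jointly_continuous3 u)
  (Lu : R)
  (u_lip : forall (t : R) (f0 f0' : Bb) (f f' : 'I_n -> Bb),
     norm (minus (u t f0 f) (u t f0' f'))
     <= Lu * (norm (minus f0 f0') + sum_norm (diff f f')))
  (kappa omega : R) (hkappa : 0 < kappa) (homega : 0 < omega < 1)
  (hsmooth : smoothing j1 S kappa omega)
  (hsmoothb : smoothing j1b Sb kappa omega) :
  exists T0 : B1 -> B1b -> R,
    (* unique solvability on [a,T] for all T in (a, T0(Y,Z)) *)
    (forall (Y : B1) (Z : B1b),
       a < T0 Y Z /\
       forall T, a < T < T0 Y Z ->
       exists (b : Contin a T B1) (f : Contin a T B1b),
         mild_solution j1 j1b D Db S Sb H (Hb T) u Y Z b f /\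
         forall (b' : Contin a T B1) (f' : Contin a T B1b),
           mild_solution j1 j1b D Db S Sb H (Hb T) u Y Z b' f' ->
           forall t, a <= t <= T -> b' t = b t /\ f' t = f t) /\
    (* T0 is bounded away from a on bounded sets of data, and there, for each T,
       the solution is Lipschitz in (Y,Z) as long as T remains admissible *)
    (forall r : R,
       (exists tau, a < tau /\
          forall (Y : B1) (Z : B1b), norm Y <= r -> norm Z <= r -> tau <= T0 Y Z) /\
       forall T, a < T ->
       exists L : R, forall (Y Y' : B1) (Z Z' : B1b),
         norm Y <= r -> norm Y' <= r -> norm Z <= r -> norm Z' <= r ->
         T < T0 Y Z -> T < T0 Y' Z' ->
         forall (b b' : Contin a T B1) (f f' : Contin a T B1b),
           mild_solution j1 j1b D Db S Sb H (Hb T) u Y Z b f ->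
           mild_solution j1 j1b D Db S Sb H (Hb T) u Y' Z' b' f' ->
           Cdist b b' + Cdist f f' <= L * (norm (minus Y Y') + norm (minus Z Z'))).
Proof.
have S_sg := gen_semigroup hA; have S1_sg := gen_semigroup1 hA.
have Sb_sg := gen_semigroup hAb; have S1b_sg := gen_semigroup1 hAb.
have S_restrict := gen_restrict hA; have Sb_restrict := gen_restrict hAb.
have D_lin i : is_linear (D i) /\ op_norm (D i) <= 1 by have [? []] := hD i.
have Db_lin i : is_linear (Db i) /\ op_norm (Db i) <= 1 by have [? []] := hDb i.
have [q hq] : exists q : nat, 2 <= INR q.+1 * (1 - omega).
  have [q hq] := INR_unbounded (2 / (1 - omega)); exists q.
  have e : 2 = 2 / (1 - omega) * (1 - omega) by field; lra.
  rewrite [X in X <= _]e; apply: Rmult_le_compat_r; first lra.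
  by rewrite S_INR; lra.
have omega0 : 0 <= omega by lra.
have [W hW] := smooth_kernel_exists S_sg S1_sg hM1 hm1 hS1 S_restrict hkappa hsmooth hq omega0.
have [Wb hWb] :=
  smooth_kernel_exists Sb_sg S1b_sg hM1b hm1b hS1b Sb_restrict hkappa hsmoothb hq omega0.
pose C := INR q.+1 * kappa; rewrite -/C in hW hWb.
have C0 : 0 <= C by apply: Rmult_le_pos; [exact: pos_INR | lra].
pose K := M1 * exp m1 + M1b * exp m1b.
have K1 : 0 <= M1 * exp m1 by apply: Rmult_le_pos => //; exact/Rlt_le/exp_pos.
have K2 : 0 <= M1b * exp m1b by apply: Rmult_le_pos => //; exact/Rlt_le/exp_pos.
have K0 : 0 <= K by rewrite /K; lra.
pose Lam r := lip_const n LH LH' LHpar LHb LHb' Lu r.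
pose lam := growth_const n LH LHb.
have lam_Lam r : 0 <= r -> lam <= Lam r by exact: growth_const_le.
have lam0 : 0 <= lam by have [] := lip_const_terms n LH LH' LHpar LHb LHb' Lu (Rle_refl 0).
(* The threshold of [small_time] at radius [r]; larger data leave less time. *)
pose delta r := (/ (1 + 4 * C * Lam r)) ^ q.+1.
have Lam0 r : 0 <= r -> 0 <= Lam r by move=> /lam_Lam; lra.
have delta_pos r : 0 <= r -> 0 < delta r.
  move=> r0; apply: pow_lt; apply: Rinv_0_lt_compat.
  by have := Rmult_le_pos _ _ C0 (Lam0 r r0); lra.
have delta_anti r r' : 0 <= r <= r' -> delta r' <= delta r.
  move=> rr'; apply: pow_inv_anti.
  have := Rmult_le_pos _ _ C0 (Lam0 r rr'.1).
  have : C * Lam r <= C * Lam r' by apply: Rmult_le_compat_l => //; exact: lip_const_mono.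
  by lra.
pose rad (Y : B1) (Z : B1b) := 2 * K * (norm Y + norm Z).
have rad0 Y Z : 0 <= rad Y Z.
  by apply: Rmult_le_pos; [lra | have := norm_ge_0 Y; have := norm_ge_0 Z; lra].
pose is_mild T := mild_solution j1 j1b D Db S Sb H (Hb T) u.
(* Any radius [r] above the a priori ones is allowed, so that different data can be compared in a
   common ball. *)
have core T r (aT : a < T) : 0 <= r -> T - a < delta r ->
    (forall Y Z, rad Y Z <= r -> exists (b : Contin a T B1) (f : Contin a T B1b),
      is_mild T Y Z b f) /\
    (forall Y Y' Z Z' (b b' : Contin a T B1) (f f' : Contin a T B1b),
      rad Y Z <= r -> rad Y' Z' <= r -> is_mild T Y Z b f -> is_mild T Y' Z' b' f' ->
      Cdist b b' + Cdist f f' <= 2 * K * (ndist Y Y' + ndist Z Z')).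
  move=> r0 Tr; have aT' := Rlt_le _ _ aT.
  have Ta0 : 0 <= T - a by lra.
  have [hLam Ta1] := small_time C0 (Lam0 r r0) Ta0 Tr.
  have {}Ta1 : T <= a + 1 by lra.
  pose eps := C * root q (T - a).
  have eps0 : 0 <= eps by apply: Rmult_le_pos => //; exact: root_ge0.
  have hlam : eps * lam <= / 2.
    have := Rmult_le_compat_l _ _ _ eps0 (lam_Lam r r0); rewrite -/eps in hLam; lra.
  pose F := forcing aT' j1 j1b D_lin Db_lin H_cont u_cont.
  pose Fb := forcing_back aT' j1 j1b Db_lin (Hb_cont T aT).
  have P Y Z b f : is_mild T Y Z b f <->
      coupled (forward_mild j1 S a T) (backward_mild j1b Sb a T) F Fb Y Z b f.
    exact: mild_solutionP.
  have mild_dist Y Y' (g g' : Contin a T B) (b b' : Contin a T B1) :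
      forward_mild j1 S a T Y g b -> forward_mild j1 S a T Y' g' b' ->
      Cdist b b' <= K * ndist Y Y' + eps * Cdist g g'.
    move=> h h'; apply: Cdist_le => // t ht.
    apply: Rle_trans (ndist_forward_mild S_sg S1_sg hM hm hM1 hm1 hS hS1 S_restrict
      C0 hW aT Ta1 h h' ht) _.
    apply: Rplus_le_compat_r; apply: Rmult_le_compat_r; first exact: ndist_ge0.
    by rewrite /K; lra.
  have mildb_dist Z Z' (g g' : Contin a T Bb) (f f' : Contin a T B1b) :
      backward_mild j1b Sb a T Z g f -> backward_mild j1b Sb a T Z' g' f' ->
      Cdist f f' <= K * ndist Z Z' + eps * Cdist g g'.
    move=> h h'; apply: Cdist_le => // t ht.
    apply: Rle_trans (ndist_backward_mild Sb_sg S1b_sg hMb hmb hM1b hm1b hSb hS1b Sb_restrict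
      C0 hWb aT Ta1 h h' ht) _.
    apply: Rplus_le_compat_r; apply: Rmult_le_compat_r; first exact: ndist_ge0.
    by rewrite /K; lra.
  have mild0 : forward_mild j1 S a T zero (zero_curve a T B) (zero_curve a T B1).
    exact: forward_mild_zero.
  have mildb0 : backward_mild j1b Sb a T zero (zero_curve a T Bb) (zero_curve a T B1b).
    exact: backward_mild_zero.
  have F_growth := forcing_growth aT' j1 j1b D_lin Db_lin H_cont u_cont LHb H_bound.
  have Fb_growth := forcing_back_growth aT' j1 j1b Db_lin (Hb_cont T aT) LH (Hb_bound T aT).
  have F_lip := @forcing_lip _ _ aT' _ _ _ _ _ j1 j1b _ _ _ D_lin Db_lin _ _ H_cont u_cont
    _ _ _ LHb LHb' _ H_lip H_lip_par u_lip.
  have Fb_lip := @forcing_back_lip _ _ aT' _ _ _ _ j1 j1b _ _ Db_lin _ (Hb_cont T aT)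
    LH LH' LHpar _ _ Lu (Hb_lip T aT) (Hb_lip_curve T aT).
  split=> [Y Z YZ|Y Y' Z Z' b b' f f' YZ YZ' /P h /P h'].
    have [b [f hbf]] : exists b f,
        coupled (forward_mild j1 S a T) (backward_mild j1b Sb a T) F Fb Y Z b f.
      apply: (@coupled_exists a T aT' _ _ _ _ _ _
        (duhamel_curve S1_sg hM1 hm1 hS1 C0 hW aT Ta1)
        (duhamel_back S1b_sg hM1b hm1b hS1b C0 hWb aT Ta1) K eps K0 eps0
        _ _ _ _ mild_dist mildb_dist mild0 mildb0 _ _ lam Lam F_growth Fb_growth
        F_lip Fb_lip hlam r hLam Y Z YZ).
      - by move=> Y0 g; exact: (duhamel_mild S_sg hM hm hS S_restrict).
      - by move=> Z0 g; exact: (duhamel_back_mild Sb_sg hMb hmb hSb Sb_restrict).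
      - move=> Y0 g b b' bb'; apply: forward_mild_ext => // t ht; apply: ndist_eq0.
        exact: Rle_trans (le_Cdist aT' b b' ht) bb'.
      move=> Z0 g f f' ff'; apply: backward_mild_ext => // t ht; apply: ndist_eq0.
      exact: Rle_trans (le_Cdist aT' f f' ht) ff'.
    by exists b, f; apply/P.
  exact: (coupled_dist aT' K0 eps0 mild_dist mildb_dist mild0 mildb0 F_growth Fb_growth
    F_lip Fb_lip hlam hLam YZ YZ' h h').
exists (fun Y Z => a + delta (rad Y Z)); split=> [Y Z|r].
  have d0 := delta_pos _ (rad0 Y Z); split=> [|T [aT hT]]; first lra.
  have Td : T - a < delta (rad Y Z) by lra.
  have [ex un] := core T _ aT (rad0 Y Z) Td.
  have [b [f hbf]] := ex Y Z (Rle_refl _).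
  exists b, f; split=> // b' f' hbf' t ht.
  (* Uniqueness is the Lipschitz estimate for equal data. *)
  have := un _ _ _ _ _ _ _ _ (Rle_refl _) (Rle_refl _) hbf' hbf; rewrite !ndist_self => h.
  have aT' := Rlt_le _ _ aT; have db := Cdist_ge0 aT' b' b; have df := Cdist_ge0 aT' f' f.
  split; apply: ndist_eq0.
    by apply: Rle_trans (le_Cdist aT' b' b ht) _; lra.
  by apply: Rle_trans (le_Cdist aT' f' f ht) _; lra.
split.
  (* Bounds the radii of all data of norm at most [r]; [Rabs] keeps it nonnegative when [r] is
     negative. *)
  pose R0 := 2 * K * (Rabs r + Rabs r).
  have R00 : 0 <= R0 by apply: Rmult_le_pos; have := Rabs_pos r; lra.
  exists (a + delta R0); split=> [|Y Z Yr Zr]; first by have := delta_pos _ R00; lra.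
  apply: Rplus_le_compat_l; apply: delta_anti; split; first exact: rad0.
  by apply: Rmult_le_compat_l; [lra | have := Rle_abs r; lra].
move=> T aT; exists (2 * K) => Y Y' Z Z' _ _ _ _ hT hT' b b' f f' h h'.
(* [delta r'] is one of the two given margins, so [T] is admissible for the common radius. The
   constant [2 * K] depends neither on [T] nor on [r]. *)
pose r' := Rmax (rad Y Z) (rad Y' Z').
have Tr' : T - a < delta r' by rewrite /r' /Rmax; case: Rle_dec => _; lra.
have r'0 : 0 <= r' := Rle_trans _ _ _ (rad0 Y Z) (Rmax_l _ _).
exact: (core T r' aT r'0 Tr').2 _ _ _ _ _ _ _ _ (Rmax_l _ _) (Rmax_r _ _) h h'.
Qed.
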